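(* Fix any $\epsilon>0$. The following problem is $\#\mathrm{W}[1]$-hard with $k$ as the parameter: given $k\le n$ and a $k\times n$ matrix $A=(A_{i,j})$ whose entries $A_{i,j}$ are $n^{\epsilon}\times n^{\epsilon}$ matrices over $\mathbb{Q}$, compute $\mathrm{rdet}(A)=\sum_{S\subseteq[n],|S|=k}\sum_{\sigma\in S_k}\mathrm{sgn}(\sigma)\,A_{1,s_{\sigma(1)}}A_{2,s_{\sigma(2)}}\cdots A_{k,s_{\sigma(k)}}$, where $S=\{s_1<s_2<\dots<s_k\}$ and products are matrix products taken in the given order.
   Context: $\mathrm{rdet}(A)$ is the evaluation over a matrix algebra of the noncommutative rectangular determinant $\sum_{S\subseteq[n],|S|=k}\mathrm{Det}(Y_S)$ of a $k\times n$ matrix of noncommuting variables, where $\mathrm{Det}(Z)=\sum_{\sigma\in S_k}\mathrm{sgn}(\sigma)z_{1,\sigma(1)}\cdots z_{k,\sigma(k)}$ (row order left to right) and $Y_S$ is the submatrix with columns in $S$. $\#\mathrm{W}[1]$ is the parameterized counting class (e.g. counting simple paths of length $k$ in a directed graph is $\#\mathrm{W}[1]$-complete); hardness is with respect to parameterized (fpt) reductions. *)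

(* Defs.v *)
From HB Require Import structures.
From mathcomp Require Import all_boot all_order all_fingroup all_algebra.
From mathcomp Require Import reals exp.

Set Implicit Arguments.
Unset Strict Implicit.
Unset Printing Implicit Defensive.

Import Order.TTheory GRing.Theory Num.Theory.

(* The factors of [\prod_(i < k)] are multiplied by increasing row index, and
   [T] need not be commutative. *)
Definition ncdet (T : pzRingType) (k : nat) (Z : 'M[T]_k) : T :=
  (\sum_(s : 'S_k) (-1) ^+ s * \prod_(i < k) Z i (s i))%R.

(* [enum_val] lists the elements of [S : {set 'I_n}] in increasing order. *)
Definition rdet (T : pzRingType) (k n : nat) (A : 'M[T]_(k, n)) : T :=
  (\sum_(S : {S : {set 'I_n} | #|S| == k})
    ncdet (\matrix_(i < k, j < k)
      A i (enum_val (cast_ord (esym (eqP (valP S))) j))))%R.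

(* A tree is also the list of the left subtrees along its right spine; this
   makes every decoding function below total. *)
Inductive tree : Type := Nil | Cons of tree & tree.

Fixpoint tsize (t : tree) : nat :=
  if t is Cons l r then (tsize l + tsize r).+1 else 1.

Definition hd (t : tree) : tree := if t is Cons l _ then l else Nil.
Definition tl (t : tree) : tree := if t is Cons _ r then r else Nil.
Definition is_cons (t : tree) : bool := if t is Cons _ _ then true else false.

Fixpoint dec_seq (t : tree) : seq tree :=
  if t is Cons l r then l :: dec_seq r else [::].
Definition enc_seq (s : seq tree) : tree := foldr Cons Nil s.

Definition entry (t : tree) (i : nat) : tree := nth Nil (dec_seq t) i.

Definition enc_unary (n : nat) : tree := enc_seq (nseq n Nil).
Definition dec_unary (t : tree) : nat := size (dec_seq t).

Definition enc_bit (b : bool) : tree := if b then Cons Nil Nil else Nil.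

(* Binary, least significant bit first; [up_log 2 n.+1] is the bit length. *)
Definition enc_nat (n : nat) : tree :=
  enc_seq [seq enc_bit (odd (n %/ 2 ^ i)) | i <- iota 0 (up_log 2 n.+1)].
Definition dec_nat (t : tree) : nat :=
  foldr (fun b m => is_cons b + m.*2) 0 (dec_seq t).

(* Sign bit, then numerator and denominator in binary. *)
Definition enc_rat (q : rat) : tree :=
  Cons (enc_bit (q < 0)%R) (Cons (enc_nat `|numq q|%N) (enc_nat `|denq q|%N)).
Definition dec_rat (t : tree) : rat :=
  ((-1) ^+ is_cons (hd t) *
    ((dec_nat (hd (tl t)))%:R / (dec_nat (tl (tl t)))%:R))%R.

(* Matrices are lists of rows; entries missing from the list are read as 0. *)
Definition enc_mx (d : nat) (M : 'M[rat]_d) : tree :=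
  enc_seq [seq enc_seq [seq enc_rat (M i j) | j <- enum 'I_d] | i <- enum 'I_d].
Definition dec_mx (d : nat) (t : tree) : 'M[rat]_d :=
  \matrix_(i, j) dec_rat (entry (entry t i) j).

Lemma enc_seqK : cancel enc_seq dec_seq.
Proof. by elim=> //= x s ->. Qed.

Lemma enc_unaryK : cancel enc_unary dec_unary.
Proof. by move=> n; rewrite /dec_unary enc_seqK size_nseq. Qed.

Lemma enc_natK : cancel enc_nat dec_nat.
Proof.
move=> n; rewrite /dec_nat /enc_nat enc_seqK.
have : n < 2 ^ up_log 2 n.+1 by apply: up_logP.
move: (up_log 2 n.+1) => m; elim: m n => [|m IHm] n /=; first by case: n.
rewrite expnS mul2n -ltn_half_double => /IHm IH.
rewrite expn0 divn1 -[1%N]/(1 + 0)%N (iotaDl 1 0) -map_comp.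
have -> : is_cons (enc_bit (odd n)) = odd n by case: (odd n).
rewrite -[RHS]odd_double_half -[in RHS]IH; congr (_ + (foldr _ _ _).*2).
by apply: eq_map => i /=; rewrite add1n -divn2 -divnMA expnS.
Qed.

Lemma enc_ratK : cancel enc_rat dec_rat.
Proof.
move=> q; rewrite /dec_rat /= !enc_natK.
have -> : is_cons (enc_bit (q < 0)%R) = (q < 0)%R by case: (q < 0)%R.
rewrite mulrA -[RHS]divq_num_den !pmulrn absz_denq -numq_lt0.
by rewrite [in RHS](intEsign (numq q)) rmorphM rmorph_sign.
Qed.

Lemma enc_mxK (d : nat) : cancel (@enc_mx d) (@dec_mx d).
Proof.
move=> M; apply/matrixP => i j; rewrite mxE /entry enc_seqK.
rewrite (nth_map i) ?size_enum_ord // nth_ord_enum enc_seqK.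
by rewrite (nth_map j) ?size_enum_ord // nth_ord_enum enc_ratK.
Qed.

Inductive expr : Type :=
  | EVar of nat | ENil | ECons of expr & expr | EHd of expr | ETl of expr.

Inductive cmd : Type :=
  | Assign of nat & expr
  | Query of nat & expr
  | Seq of cmd & cmd
  | If of expr & cmd & cmd
  | While of expr & cmd.

Definition store : Type := nat -> tree.

Definition upd (s : store) (v : nat) (t : tree) : store :=
  fun w => if w == v then t else s w.

Fixpoint eval (s : store) (e : expr) : tree :=
  match e with
  | EVar v => s v
  | ENil => Nil
  | ECons e1 e2 => Cons (eval s e1) (eval s e2)
  | EHd e => hd (eval s e)
  | ETl e => tl (eval s e)
  end.

(* [exec O c s s' t qs]: with oracle [O], running [c] from [s] halts in [s']
   after time [t], having asked the queries [qs]. Time charges the full tree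
   size of every value that is stored or sent to the oracle, so that it is
   polynomially related to Turing machine time (with unit cost per assignment,
   repeated [x := Cons x x] would build trees of exponential size). *)
Inductive exec (O : tree -> tree) :
    cmd -> store -> store -> nat -> seq tree -> Prop :=
  | XAssign v e s :
      exec O (Assign v e) s (upd s v (eval s e)) (tsize (eval s e)) [::]
  | XQuery v e s :
      exec O (Query v e) s (upd s v (O (eval s e)))
        (tsize (eval s e) + tsize (O (eval s e))) [:: eval s e]
  | XSeq c1 c2 s s1 s2 t1 t2 qs1 qs2 :
      exec O c1 s s1 t1 qs1 -> exec O c2 s1 s2 t2 qs2 ->
      exec O (Seq c1 c2) s s2 (t1 + t2) (qs1 ++ qs2)
  | XIfTrue e c1 c2 s s' t qs :
      is_cons (eval s e) -> exec O c1 s s' t qs ->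
      exec O (If e c1 c2) s s' t.+1 qs
  | XIfFalse e c1 c2 s s' t qs :
      ~~ is_cons (eval s e) -> exec O c2 s s' t qs ->
      exec O (If e c1 c2) s s' t.+1 qs
  | XWhileTrue e c s s1 s2 t1 t2 qs1 qs2 :
      is_cons (eval s e) -> exec O c s s1 t1 qs1 ->
      exec O (While e c) s1 s2 t2 qs2 ->
      exec O (While e c) s s2 (t1 + t2).+1 (qs1 ++ qs2)
  | XWhileFalse e c s :
      ~~ is_cons (eval s e) -> exec O (While e c) s s 1 [::].

Definition init (x : tree) : store := upd (fun _ => Nil) 0 x.

Definition runs_with (O : tree -> tree) (c : cmd) (x y : tree) (t : nat)
    (qs : seq tree) : Prop :=
  exists2 s, exec O c (init x) s t qs & s 0 = y.

(* Computation without oracle: the constant oracle provides no information. *)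
Definition runs (c : cmd) (x y : tree) (t : nat) : Prop :=
  exists qs, runs_with (fun _ => Nil) c x y t qs.

Definition computable (f : nat -> nat) : Prop :=
  exists c, forall k, exists t, runs c (enc_unary k) (enc_unary (f k)) t.

(* The two arguments are the instance and the parameter. *)
Definition counting_problem : Type := tree -> nat -> nat.
Definition function_problem : Type := tree -> nat -> tree.

Definition enc_inst (x : tree) (k : nat) : tree := Cons x (enc_unary k).

Definition oracle (P : function_problem) (q : tree) : tree :=
  P (hd q) (dec_unary (tl q)).

Definition fpt_parsimonious (F G : counting_problem) : Prop :=
  exists (c : cmd) (f g : nat -> nat) (e : nat),
    [/\ computable f, computable g &
      forall x k, exists y l t,
        [/\ runs c (enc_inst x k) (enc_inst y l) t,
            t <= f k * tsize x ^ e, l <= g k & F x k = G y l]].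

Definition fpt_turing (F : counting_problem) (P : function_problem) : Prop :=
  exists (c : cmd) (f g : nat -> nat) (e : nat),
    [/\ computable f, computable g &
      forall x k, exists t qs,
        [/\ runs_with (oracle P) c (enc_inst x k) (enc_nat (F x k)) t qs,
            t <= f k * tsize x ^ e &
            all (fun q => dec_unary (tl q) <= g k) qs]].

(* A tree is read as the adjacency matrix of a simple graph on as many vertices
   as it has rows: [i != j] are adjacent when both bits (i, j) and (j, i) are
   set. *)
Definition adj (x : tree) (i j : nat) : bool :=
  [&& i != j, is_cons (entry (entry x i) j) & is_cons (entry (entry x j) i)].

Definition sharp_clique : counting_problem := fun x k =>
  #|[set S : {set 'I_(dec_unary x)} | (#|S| == k) &&
      [forall i in S, forall j in S, (i != j) ==> adj x i j]]|.

(* #W[1] as the closure of its standard complete problem, counting k-cliques,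
   under fpt parsimonious reductions; hardness for it is under fpt Turing
   reductions, the answers of P being matrices rather than numbers. *)
Definition sharpW1 (F : counting_problem) : Prop :=
  fpt_parsimonious F sharp_clique.

Definition sharpW1_hard (P : function_problem) : Prop :=
  forall F : counting_problem, sharpW1 F -> fpt_turing F P.

(* The instance [x] lists n and d in unary, followed by the k x n matrix of
   d x d matrices, where d is n^eps rounded down; the parameter k is the number
   of rows. Inputs that violate k <= n or the condition on d are answered by
   [Nil]. *)
Definition rdet_problem (R : realType) (eps : R) : function_problem :=
  fun x k =>
    let n := dec_unary (hd x) in
    let d := dec_unary (hd (tl x)) in
    let M := tl (tl x) in
    if [&& k <= n, (d%:R <= n%:R `^ eps)%R & (n%:R `^ eps < d.+1%:R)%R] then
      enc_mx (rdet (\matrix_(i < k, j < n) dec_mx d (entry (entry M i) j)))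
    else Nil.

(* Main.v *)
Require Import Defs.
From mathcomp Require Import all_boot all_order all_fingroup all_algebra.
From mathcomp Require Import reals exp.
From mathcomp Require Import zify.

(** The reduction counts the k-cliques of a graph directly, with no
    interpolation. Expanding the matrix products turns the (0, 0) entry of [rdet]
    into a sum, over the vertex sequences [g] that the entries guess, of scalar
    signed sums [\sum_f sgn(f) \prod_p W p (f p)] over injections [f] of the rows
    into the columns. There is one row per ordered pair (i, j) of positions in
    the clique, and its entries only have to remember the vertex [g i]. The rows
    (i, j) and (j, i) with i < j share a block of columns, two columns per vertex
    w. Row (i, j) picks, with weight 1 or -1, the first or second column of a
    neighbour w > g i; row (j, i) picks the first column of [g j]. Order signs
    cancel the contributions of all w other than [g j], because both columns of
    such a w lie on the same side of the first column of [g j]; so the two rows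
    together test that [g i] and [g j] are adjacent, without communicating.
    Inversions between different blocks contribute a sign that depends on k only,
    and the program reads off the absolute value of the entry.

    Since [eps] need not be computable, neither is the dimension n^[eps] rounded
    down: the program pads with zeros and asks the oracle for every dimension in
    turn, until it accepts one. *)

Set Implicit Arguments.
Unset Strict Implicit.
Unset Printing Implicit Defensive.

(* Again, because MathComp has other [tsize], [Nil] and [Cons]. *)
Import Defs.
Import Order.TTheory GRing.Theory Num.Theory.

(** * Rectangular determinants as sums over injections *)

Lemma ltn_enum_val (n : nat) (S : {set 'I_n}) (i j : 'I_#|S|) :
  i < j -> enum_val i < enum_val j.
Proof.
move=> lt_ij; have x0 := enum_val i.
have sortS : sorted (relpre val ltn) (enum S).
  rewrite /enum_mem; apply: sorted_filter; first by move=> x y z; apply: ltn_trans.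
  by rewrite -enumT -sorted_map val_enum_ord iota_ltn_sorted.
rewrite !(enum_val_nth x0).
apply: (sorted_ltn_nth _ x0 sortS) => //; rewrite ?inE -?cardE //.
by move=> x y z; apply: ltn_trans.
Qed.

Local Open Scope ring_scope.

(* The sign of an injection; 0 on the other functions, as [Num.sg 0 = 0]. *)
Definition inv_sign (k n : nat) (f : 'I_k -> 'I_n) : int :=
  \prod_(p < k) \prod_(q < k | (p < q)%N) Num.sg ((f q)%:Z - (f p)%:Z).

(** The Vandermonde determinant of the values of [s] is that of 0, ..., k-1 with its columns
    permuted, and its sign is the product of the signs of the differences. *)
Lemma inv_sign_perm (k : nat) (s : 'S_k) : inv_sign s = (-1) ^+ s.
Proof.
pose a : 'rV[int]_k := \row_i (i : nat)%:Z.
pose b : 'rV[int]_k := \row_i (s i : nat)%:Z.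
have detV : \det (Vandermonde k b) = (-1) ^+ s * \det (Vandermonde k a).
  have -> : Vandermonde k b = col_perm s (Vandermonde k a).
    by apply/matrixP => i j; rewrite !mxE.
  by rewrite col_permE det_mulmx det_perm odd_permV mulrC.
have sgV (c : 'rV[int]_k) : Num.sg (\det (Vandermonde k c)) =
    \prod_(p < k) \prod_(q < k | (p < q)%N) Num.sg (c 0 q - c 0 p).
  rewrite det_Vandermonde (big_morph _ (@sgrM _) (sgr1 _)).
  by apply: eq_bigr => p _; rewrite (big_morph _ (@sgrM _) (sgr1 _)).
have -> : inv_sign s = Num.sg (\det (Vandermonde k b)).
  by rewrite sgV; do 2!apply: eq_bigr => ? _; rewrite !mxE.
rewrite detV sgrM sgV; have -> : Num.sg ((-1) ^+ s : int) = (-1) ^+ s.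
  by case: (odd_perm s) => //; rewrite expr0 sgr1.
rewrite big1 ?mulr1 // => p _; rewrite big1 // => q lt_pq.
by rewrite !mxE gtr0_sg // subr_gt0 ltz_nat.
Qed.

Lemma inv_sign_mono (k m n : nat) (g : 'I_m -> 'I_n) (f : 'I_k -> 'I_m) :
  {homo g : i j / (i < j)%N} -> inv_sign (g \o f) = inv_sign f.
Proof.
move=> g_mono; apply: eq_bigr => p _; apply: eq_bigr => q _ /=.
case: (ltngtP (f p) (f q)) => [lt_pq|lt_qp|/ord_inj->]; last by rewrite !subrr.
  by rewrite !gtr0_sg ?subr_gt0 ?ltz_nat ?g_mono.
by rewrite !ltr0_sg ?subr_lt0 ?ltz_nat ?g_mono.
Qed.

Lemma inv_sign_noninj (k n : nat) (f : {ffun 'I_k -> 'I_n}) :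
  ~~ injectiveb f -> inv_sign f = 0.
Proof.
move=> /injectivePn[p [q neq_pq eq_f]].
wlog lt_pq : p q neq_pq eq_f / (p < q)%N.
  move=> IH; case: (ltngtP p q) => [lt|lt|/ord_inj eq_pq].
  - exact: IH lt.
  - by apply: IH lt => //; rewrite eq_sym.
  - by rewrite eq_pq eqxx in neq_pq.
rewrite /inv_sign (bigD1 p) //= (bigD1 (P := fun j => (p < j)%N) q) //=.
by rewrite eq_f subrr sgr0 !mul0r.
Qed.

(** Isolates the column selection inside [rdet]; it also lists the vertices of a clique later on. *)
Definition enum_fun (k n : nat) (S : {S : {set 'I_n} | #|S| == k}) (i : 'I_k) : 'I_n :=
  enum_val (cast_ord (esym (eqP (valP S))) i).

Lemma enum_fun_mono (k n : nat) (S : {S : {set 'I_n} | #|S| == k}) :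
  {homo enum_fun S : i j / (i < j)%N}.
Proof. by move=> i j lt_ij; apply: ltn_enum_val. Qed.

Lemma enum_fun_inj (k n : nat) (S : {S : {set 'I_n} | #|S| == k}) :
  injective (enum_fun S).
Proof. by move=> i j /enum_val_inj/cast_ord_inj. Qed.

Lemma mem_enum_fun (k n : nat) (S : {S : {set 'I_n} | #|S| == k}) (x : 'I_n) :
  x \in val S -> exists i, x = enum_fun S i.
Proof.
move=> Sx; exists (cast_ord (eqP (valP S)) (enum_rank_in Sx x)).
by rewrite /enum_fun cast_ordK enum_rankK_in.
Qed.

Lemma imset_enum_fun (k n : nat) (S : {S : {set 'I_n} | #|S| == k}) (s : 'S_k) :
  [ffun i => enum_fun S (s i)] @: 'I_k = val S.
Proof.
apply/setP => x; apply/imsetP/idP => [[i _ ->]|/mem_enum_fun[i ->]].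
  by rewrite ffunE enum_valP.
by exists (s^-1 i)%g; rewrite // ffunE permKV.
Qed.

(** An injection is, in a unique way, a permutation followed by the increasing enumeration of its
    image; by [inv_sign_mono] the enumeration does not affect the sign. On all other functions
    [inv_sign] is 0. *)
Lemma rdetE (T : pzRingType) (k n : nat) (A : 'M[T]_(k, n)) :
  rdet A = \sum_(f : {ffun 'I_k -> 'I_n}) (\prod_(p < k) A p (f p)) *~ inv_sign f.
Proof.
rewrite [RHS](bigID (fun f : {ffun 'I_k -> 'I_n} => injectiveb f)) /=.
rewrite [X in _ + X]big1 ?addr0; last first.
  by move=> f /inv_sign_noninj->; rewrite mulr0z.
rewrite (partition_big (fun f : {ffun 'I_k -> 'I_n} => f @: 'I_k)
  (fun S : {set 'I_n} => #|S| == k)) /=; last first.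
  by move=> f /injectiveP inj_f; rewrite card_imset // card_ord.
rewrite (reindex_omap (val : {S : {set 'I_n} | #|S| == k} -> {set 'I_n}) insub) /=; last first.
  by move=> S Sk; rewrite insubT.
rewrite /rdet; apply: eq_big => [S|S _]; first by rewrite (valP S) valK eqxx.
pose h (s : 'S_k) : {ffun 'I_k -> 'I_n} := [ffun i => enum_fun S (s i)].
have inj_h : injective h.
  move=> s t /ffunP eq_st; apply/permP => i; apply: (@enum_fun_inj _ _ S).
  by have:= eq_st i; rewrite !ffunE.
rewrite (eq_bigl (mem (h @: 'S_k))) => [|f]; last first.
  apply/andP/imsetP => [[/injectiveP inj_f /eqP im_f]|[s _ ->]]; last first.
    rewrite imset_enum_fun eqxx; split=> //; apply/injectiveP => i j.
    by rewrite !ffunE => /enum_fun_inj/perm_inj.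
  (* The positions of the values of [f] inside S form the required permutation. *)
  have fS i : {j | f i == enum_fun S j}.
    by apply: sigW; case: (@mem_enum_fun _ _ S (f i)) => [|j ->]; [rewrite -[val S]im_f imset_f|exists j].
  have inj_g : injective (fun i => sval (fS i)).
    move=> i j eq_ij; apply: inj_f.
    by rewrite (eqP (svalP (fS i))) (eqP (svalP (fS j))) eq_ij.
  exists (perm inj_g) => //; apply/ffunP => i; rewrite ffunE permE.
  exact/eqP/(svalP (fS i)).
rewrite big_imset /=; last by move=> s t _ _; apply: inj_h.
rewrite /ncdet [RHS](eq_bigl xpredT) => [|s]; last by rewrite inE.
apply: eq_bigr => s _.
have -> : inv_sign (h s) = (-1) ^+ s.
  rewrite -inv_sign_perm -(inv_sign_mono _ (@enum_fun_mono _ _ S)).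
  by do 2!apply: eq_bigr => ? _; rewrite !ffunE.
rewrite -mulrzl rmorphXn rmorphN1; congr (_ * _).
by apply: eq_bigr => i _; rewrite mxE ffunE.
Qed.
Lemma sgr_monotone (a : nat -> nat) (x y : nat) :
  {homo a : x y / (x <= y)%N} -> a x != a y ->
  Num.sg (y%:Z - x%:Z) = Num.sg ((a y)%:Z - (a x)%:Z).
Proof.
move=> a_mono; case: (ltngtP (a x) (a y)) => // lt_a _.
  have lt_xy : (x < y)%N by rewrite ltnNge; apply: contraL lt_a => /a_mono; rewrite -leqNgt.
  by rewrite !gtr0_sg ?subr_gt0 ?ltz_nat.
have lt_yx : (y < x)%N by rewrite ltnNge; apply: contraL lt_a => /a_mono; rewrite -leqNgt.
by rewrite !ltr0_sg ?subr_lt0 ?ltz_nat.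
Qed.

(* The last row of a block picks a column that is known in advance, so inside
   the sum the sign becomes a product of factors each of which depends on the
   value of [f] at a single row. *)
Lemma sum_inv_sign (T : comPzRingType) (k n : nat) (W : 'I_k -> 'I_n -> T)
    (b : 'I_k -> nat) (c : nat -> nat) (t : 'I_k -> int) :
  {homo c : x y / (x <= y)%N} ->
  (forall p x, W p x != 0 -> c x = b p) ->
  (forall (p q : 'I_k) x, (p < q)%N -> b p = b q -> W q x != 0 -> x%:Z = t q) ->
  \sum_(f : {ffun 'I_k -> 'I_n}) (\prod_p W p (f p)) *~ inv_sign f =
  (\prod_(p < k) \prod_(q < k | (p < q)%N && (b p != b q))
     Num.sg ((b q)%:Z - (b p)%:Z))%:~R *
  \prod_p \sum_x W p x *~
    (\prod_(q < k | (p < q)%N && (b p == b q)) Num.sg (t q - x%:Z)).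
Proof.
(* [b] is the block of a row, [c] the block of a column, and [t] the only column open to a row that
   follows another row of its block. *)
move=> c_mono Wc Wt; rewrite bigA_distr_bigA mulr_sumr; apply: eq_bigr => f _.
have -> : \prod_p (W p (f p) *~
      (\prod_(q < k | (p < q)%N && (b p == b q)) Num.sg (t q - (f p)%:Z))) =
    \prod_p W p (f p) * (\prod_(p < k) \prod_(q < k | (p < q)%N && (b p == b q))
      Num.sg (t q - (f p)%:Z))%:~R.
  rewrite rmorph_prod -big_split /=; apply: eq_bigr => p _.
  by rewrite mulrzr.
(* A zero weight annihilates both sides, so afterwards every chosen entry is nonzero. *)
case: (boolP [exists p, W p (f p) == 0]) => [/existsP[p /eqP Wp0]|].
  by rewrite (bigD1 p) //= Wp0 !mul0r mulr0 mul0rz.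
rewrite negb_exists => /forallP Wf_neq0.
rewrite mulrCA -rmorphM mulrzr -big_split /=; congr (_ *~ _).
(* Columns of rows in different blocks are ordered as the blocks are; within a block the later
   column is [t q]. *)
apply: eq_bigr => p _; rewrite (bigID (fun q => b p != b q)) /=; congr (_ * _).
  apply: eq_bigr => q /andP[_ neq_b].
  rewrite -(Wc _ _ (Wf_neq0 p)) -(Wc _ _ (Wf_neq0 q)).
  by apply: (sgr_monotone c_mono); rewrite (Wc _ _ (Wf_neq0 p)) (Wc _ _ (Wf_neq0 q)).
apply: eq_big => [q|q /andP[lt_pq]]; first by rewrite negbK.
by rewrite negbK => /eqP eq_b; rewrite -(Wt _ _ _ lt_pq eq_b (Wf_neq0 q)).
Qed.

(** * Products of gate matrices *)

Lemma big_ord_mul (T : Type) (idx : T) (op : Monoid.law idx) (a l : nat)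
    (F : nat -> T) :
  \big[op/idx]_(p < a * l) F p =
  \big[op/idx]_(i < a) \big[op/idx]_(j < l) F (i * l + j)%N.
Proof.
elim: a => [|a IHa]; first by rewrite !big_ord0.
rewrite big_ord_recr -IHa -!(big_mkord xpredT F) (@big_cat_nat _ _ _ (a * l)) //=.
  rewrite mulSn addnC -{2}[(a * l)%N]add0n big_addn addKn.
  by congr (op _ _); rewrite big_mkord; apply: eq_bigr => j _; rewrite addnC.
by rewrite leq_mul2r leqnSn orbT.
Qed.

(* A row stays in the state u, except that the last row of a group is followed by
   a jump to an arbitrary state, where the next vertex is guessed. *)
Definition gate (T : comPzRingType) (m d : nat) (last : bool) (w : 'I_d -> T) : 'M[T]_d :=
  \matrix_(u, v) ((if last then (v < m)%N else u == v)%:R * w u).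

(** The matrix of the initial row, which guesses the first vertex. *)
Definition jump (T : comPzRingType) (m d : nat) : 'M[T]_d :=
  \matrix_(u, v) ((u < m) && (v < m))%N%:R.

(** All gates before the last are diagonal, so the state is still u when the last one is reached,
    and that one leads to every v below m. *)
Lemma gate_prod (T : comPzRingType) (l m d : nat) (w : nat -> 'I_d -> T) (u v : 'I_d) :
  (0 < l)%N ->
  (\prod_(j < l) gate m (j.+1 == l) (w j)) u v = (v < m)%N%:R * \prod_(j < l) w j u.
Proof.
case: l => // l _; rewrite !big_ord_recr /= eqxx.
have prodE k : (k <= l)%N ->
    \prod_(j < k) gate m (j.+1 == l.+1) (w j) = diag_mx (\row_u \prod_(j < k) w j u).
  elim: k => [|k IHk] lt_kl.
    by rewrite big_ord0; apply/matrixP => i j; rewrite !mxE big_ord0.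
  rewrite big_ord_recr /= IHk ?(ltnW lt_kl) //.
  apply/matrixP => i j; rewrite -[LHS]/((_ *m _) i j) mul_diag_mx !mxE eqSS (ltn_eqF lt_kl).
  by rewrite big_ord_recr /= mulrCA mulr_natl.
rewrite prodE // -[LHS]/((_ *m _) u v).
by rewrite mul_diag_mx !mxE mulrCA.
Qed.

(** By [gate_prod] the matrix of a group is a column vector times a row vector: the new state is
    independent of the old one, so the sums over the states guessed for different groups
    separate. *)
Lemma jump_gate_prod (T : comPzRingType) (l m d : nat)
    (w : nat -> nat -> 'I_d -> T) (u v : 'I_d) :
  (jump T m d * \prod_(i < l) \prod_(j < l) gate m (j.+1 == l) (w i j)) u v =
  ((u < m) && (v < m))%N%:R * \prod_(i < l) \sum_(x < d | (x < m)%N) \prod_(j < l) w i j x.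
Proof.
(* The number k of groups is freed for the induction, while the length l of each group stays
   fixed. *)
suff: forall k v, (k <= l)%N ->
    (jump T m d * \prod_(i < k) \prod_(j < l) gate m (j.+1 == l) (w i j)) u v =
    ((u < m) && (v < m))%N%:R *
      \prod_(i < k) \sum_(x < d | (x < m)%N) \prod_(j < l) w i j x by apply.
elim=> [|k IHk] {}v lt_kl; first by rewrite !big_ord0 !mulr1 mxE.
rewrite !big_ord_recr /= !mulrA mxE.
rewrite (eq_bigr (fun x : 'I_d => ((x < m)%N%:R * \prod_(j < l) w k j x) *
   (((u < m) && (v < m))%N%:R * \prod_(i < k) \sum_(x < d | (x < m)%N) \prod_(j < l) w i j x)))
   => [|x _].
  rewrite -mulr_suml [RHS]mulrC; congr (_ * _).
  by rewrite [RHS]big_mkcond; apply: eq_bigr => x _; case: ifP; rewrite ?mul1r ?mul0r.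
rewrite IHk ?(ltnW lt_kl) //; have gE := gate_prod m (w k) x v (leq_ltn_trans (leq0n k) lt_kl).
rewrite [X in _ * X = _]gE.
by case: (u < m)%N; case: (v < m)%N; case: (x < m)%N; rewrite ?mul0r ?mul1r ?mulr0 ?mul0r // mulrC.
Qed.
(** * Detecting cliques *)

(* [live] says that row (i, j) may pick the copy s of vertex w in block (a, b)
   while the guessed vertex is u. The vertex N is a phantom that keeps the
   matrices nonempty on the empty graph; hence [u < N]. *)
Definition live (e : rel nat) (N i j a b w s u : nat) : bool :=
  if (i < j)%N then [&& a == i, b == j & e u w]
  else [&& a == j, b == i, s == 0%N, u == w & (u < N)%N].

(* Column 0 is for the initial row only; column [((a * l + b) * m + w) * 2 + s + 1]
   is the copy s of vertex w in block (a, b). *)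
Definition weight (T : comPzRingType) (e : rel nat) (N m l i j c u : nat) : T :=
  if c is x.+1 then
    let h := (x %/ 2 %/ m)%N in
    (-1) ^+ (x %% 2)%N *
      (live e N i j (h %/ l)%N (h %% l)%N (x %/ 2 %% m)%N (x %% 2)%N u)%:R
  else 0.

Definition block (l i j : nat) : nat := if (i < j)%N then (i * l + j)%N else (j * l + i)%N.

(** The layout of the columns: column 0, then h blocks of m vertices with two copies each, then
    padding. *)
Lemma col_sum (T : comPzRingType) (h m n : nat) (F : nat -> T) :
  (h * (m * 2) < n)%N -> F 0%N = 0 ->
  (forall x, (h * (m * 2) <= x)%N -> F x.+1 = 0) ->
  \sum_(x < n) F x =
  \sum_(b < h) \sum_(w < m) (F ((b * m + w) * 2).+1%N + F ((b * m + w) * 2).+2%N).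
Proof.
case: n => // n; rewrite ltnS => le_n F0 Fbig.
rewrite big_ord_recl F0 add0r.
rewrite (eq_bigr (fun x : 'I_n => F x.+1)) // -(big_mkord xpredT (fun x => F x.+1)).
rewrite (@big_cat_nat _ _ _ (h * (m * 2))) //= [X in _ + X]big_nat [X in _ + X]big1 ?addr0.
  rewrite big_mkord (big_ord_mul _ _ _ (fun x => F x.+1)); apply: eq_bigr => b _.
  rewrite (big_ord_mul _ _ _ (fun x => F (b * (m * 2) + x).+1%N)).
  apply: eq_bigr => w _; rewrite big_ord_recl big_ord_recl big_ord0 /= addr0.
  by congr (F _ + F _); rewrite /bump /=; lia.
by move=> x /andP[le_x _]; apply: Fbig.
Qed.

(** For w other than v both copies of w lie on the same side of the first copy of v and cancel. For
    w = v the first copy gives [Num.sg 0 = 0], and the second lies to the right and has weight -1,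
    so that the two signs multiply to 1. *)
Lemma edge_sum (T : comPzRingType) (e : pred nat) (m h v : nat) : (v < m)%N ->
  \sum_(w < m) ((e w)%:R *~ Num.sg (((h * m + v) * 2).+1%:Z - ((h * m + w) * 2).+1%:Z)
    - (e w)%:R *~ Num.sg (((h * m + v) * 2).+1%:Z - ((h * m + w) * 2).+2%:Z))
  = (e v)%:R :> T.
Proof.
move=> lt_v; rewrite (bigD1 (Ordinal lt_v)) //= subrr sgr0 mulr0z sub0r.
rewrite ltr0_sg ?mulrN1z ?opprK; last by lia.
rewrite big1 ?addr0 // => w neq_w.
have [lt_wv|lt_vw|eq_wv] := ltngtP (w : nat) v.
- by rewrite !gtr0_sg ?subrr //; lia.
- by rewrite !ltr0_sg ?subrr //; lia.
- by case/eqP: neq_w; apply: ord_inj.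
Qed.
Arguments weight : simpl never.

Lemma weightE (T : comPzRingType) (e : rel nat) (N m l i j h w s u : nat) :
  (w < m)%N -> (s < 2)%N ->
  weight T e N m l i j ((h * m + w) * 2 + s).+1 u =
  (-1) ^+ s * (live e N i j (h %/ l)%N (h %% l)%N w s u)%:R.
Proof.
move=> lt_w lt_s; rewrite /weight divnMDl // (divn_small lt_s) addn0 modnMDl (modn_small lt_s).
by rewrite divnMDl ?(leq_ltn_trans _ lt_w) // (divn_small lt_w) addn0 modnMDl (modn_small lt_w).
Qed.

Lemma weight_neq0 (T : comPzRingType) (e : rel nat) (N m l i j x u : nat) :
  (0 < m)%N -> (i < l)%N -> (j < l)%N -> weight T e N m l i j x u != 0 ->
  exists w s, [/\ x = ((block l i j * m + w) * 2 + s).+1,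
    live e N i j (block l i j %/ l)%N (block l i j %% l)%N w s u &
    (w < m)%N && (s < 2)%N].
Proof.
move=> m_gt0 lt_i lt_j; case: x => [|x]; first by rewrite eqxx.
rewrite /weight; set a := (x %/ 2 %/ m %/ l)%N; set b := (x %/ 2 %/ m %% l)%N.
case: (boolP (live _ _ _ _ _ _ _ _ _)) => [lv _|]; last by rewrite mulr0 eqxx.
have Ex : (x %/ 2 %/ m = block l i j)%N.
  rewrite (divn_eq (x %/ 2 %/ m) l) -/a -/b /block.
  by move: lv; rewrite /live; case: ifP => _ /and3P[/eqP-> /eqP->].
exists (x %/ 2 %% m)%N, (x %% 2)%N; split; last 1 first.
- by rewrite !ltn_mod m_gt0.
- by rewrite -Ex -!divn_eq.
- by rewrite -Ex.
Qed.

Lemma block_div (l i j : nat) : (i < l)%N -> (j < l)%N ->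
  (block l i j %/ l = if i < j then i else j)%N /\
  (block l i j %% l = if i < j then j else i)%N.
Proof.
move=> lt_i lt_j; have l_gt0 := leq_ltn_trans (leq0n i) lt_i.
by rewrite /block; case: ifP => _; rewrite divnMDl // modnMDl !modn_small // !divn_small // addn0.
Qed.

Lemma ltn_block (l i j : nat) : (i < l)%N -> (j < l)%N -> (block l i j < l * l)%N.
Proof. by move=> lt_i lt_j; rewrite /block; case: ifP => _; nia. Qed.

Lemma weight_out (T : comPzRingType) (e : rel nat) (N m l i j x u : nat) :
  (0 < m)%N -> (i < l)%N -> (j < l)%N -> (l * l * (m * 2) <= x)%N ->
  weight T e N m l i j x.+1 u = 0.
Proof.
move=> m_gt0 lt_i lt_j le_x; apply/eqP; case: eqP => // /eqP.
case/(weight_neq0 m_gt0 lt_i lt_j) => w [s [[def_x] _ /andP[lt_w lt_s]]].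
have lt_b := ltn_block lt_i lt_j.
have : ((block l i j).+1 * m <= l * l * m)%N by rewrite leq_mul2r lt_b orbT.
by lia.
Qed.

Lemma sum_weight (T : comPzRingType) (e : rel nat) (N m l n i j u : nat) (g : nat -> int) :
  (0 < m)%N -> (i < l)%N -> (j < l)%N -> (l * l * (m * 2) < n)%N ->
  \sum_(x < n) weight T e N m l i j x u *~ g x =
  let h := block l i j in
  \sum_(w < m) ((live e N i j (h %/ l)%N (h %% l)%N w 0 u)%:R *~ g ((h * m + w) * 2).+1%N
    - (live e N i j (h %/ l)%N (h %% l)%N w 1 u)%:R *~ g ((h * m + w) * 2).+2%N).
Proof.
move=> m_gt0 lt_i lt_j lt_n.
rewrite (@col_sum _ (l * l) m n (fun x => weight T e N m l i j x u *~ g x)) ?mul0rz //; last first.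
  by move=> x le_x; rewrite weight_out ?mul0rz.
have l_gt0 := leq_ltn_trans (leq0n i) lt_i.
rewrite (bigD1 (Ordinal (ltn_block lt_i lt_j))) //= [X in _ + X]big1 ?addr0 => [|h neq_h].
  apply: eq_bigr => w _.
  have := weightE T e N l i j (block l i j) u (ltn_ord w) (isT : 0 < 2)%N.
  rewrite addn0 expr0 mul1r => ->.
  have := weightE T e N l i j (block l i j) u (ltn_ord w) (isT : 1 < 2)%N.
  by rewrite addn1 expr1 mulN1r => ->; rewrite mulNrz.
apply: big1 => w _.
have out s : (s < 2)%N -> weight T e N m l i j ((h * m + w) * 2 + s).+1 u = 0.
  move=> lt_s; rewrite weightE //; case: (boolP (live _ _ _ _ _ _ _ _ _)); last by rewrite mulr0.
  move=> lv; case/eqP: neq_h; apply: val_inj => /=.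
  rewrite [LHS](divn_eq h l) /block.
  by move: lv; rewrite /live; case: ifP => _ /and3P[/eqP-> /eqP->].
have := out 0%N isT; rewrite addn0 => ->; have := out 1%N isT; rewrite addn1 => ->.
by rewrite !mul0rz addr0.
Qed.

(** Such a row is live only on the first copy of its own vertex u, where the weight is 1. This
    covers the diagonal rows i = j as well, which are alone in their block. *)
Lemma sum_weight_last (T : comPzRingType) (e : rel nat) (N m l n i j u : nat) :
  (N < m)%N -> (u < N)%N -> (j <= i)%N -> (i < l)%N -> (l * l * (m * 2) < n)%N ->
  \sum_(x < n) weight T e N m l i j x u = 1.
Proof.
move=> lt_Nm lt_uN le_ji lt_i lt_n; have lt_j := leq_ltn_trans le_ji lt_i.
have m_gt0 := leq_ltn_trans (leq0n N) lt_Nm.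
rewrite (eq_bigr (fun x : 'I_n => weight T e N m l i j x u *~ 1)) => [|x _]; last by rewrite mulr1z.
rewrite (sum_weight _ _ _ _ (fun=> 1)) //=.
case: (block_div lt_i lt_j) => -> ->; rewrite ltnNge le_ji /=.
have lt_um := ltn_trans lt_uN lt_Nm.
rewrite (bigD1 (Ordinal lt_um)) //= big1 ?addr0 => [|w neq_w].
  by rewrite /live ltnNge le_ji /= !eqxx lt_uN /= subr0.
rewrite /live ltnNge le_ji /= !eqxx /=; case: eqP => [eq_uw|_]; last by rewrite subr0.
by case/eqP: neq_w; apply: ord_inj.
Qed.

(** The signs compare with the first copy of v, the column forced on the partner row (j, i) when its
    vertex is v; by [edge_sum] only the term of v survives. *)
Lemma sum_weight_first (T : comPzRingType) (e : rel nat) (N m l n i j u v : nat) :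
  (v < m)%N -> (i < j)%N -> (j < l)%N -> (l * l * (m * 2) < n)%N ->
  \sum_(x < n) weight T e N m l i j x u *~
    Num.sg (((block l i j * m + v) * 2).+1%:Z - x%:Z) = (e u v)%:R.
Proof.
move=> lt_vm lt_ij lt_j lt_n; have lt_i := ltn_trans lt_ij lt_j.
have m_gt0 := leq_ltn_trans (leq0n v) lt_vm.
rewrite (sum_weight _ _ _ _ (fun x => Num.sg (((block l i j * m + v) * 2).+1%:Z - x%:Z))) //=.
rewrite -[RHS](edge_sum T (e u) (block l i j) lt_vm).
case: (block_div lt_i lt_j) => -> ->; rewrite lt_ij.
by apply: eq_bigr => w _; rewrite /live lt_ij !eqxx.
Qed.
(** Row 0 is the initial row, and row q.+1 belongs to the ordered pair (q %/ l, q %% l) of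
    positions. *)
Definition row_weight (T : comPzRingType) (e : rel nat) (N m l : nat)
    (g : nat -> nat) (p c : nat) : T :=
  if p is q.+1 then weight T e N m l (q %/ l) (q %% l) c (g (q %/ l)%N)
  else (c == 0%N)%:R.

(** Shifted by one, so that the initial row has block 0 to itself. *)
Definition row_block (l p : nat) : nat :=
  if p is q.+1 then (block l (q %/ l)%N (q %% l)%N).+1 else 0.

Lemma row_div (l p q : nat) : p = q.+1 -> (p < (l * l).+1)%N ->
  [/\ (0 < l)%N, (q %/ l < l)%N & (q %% l < l)%N].
Proof.
move=> ->; rewrite ltnS; case: l => // l lt_q.
by rewrite ltn_mod ltn_divLR.
Qed.

(** The block number determines the unordered pair of positions, so two different rows of a block
    are (i, j) and (j, i); the one with i < j comes first. *)
Lemma row_block_eq (l p q : nat) :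
  (q < (l * l).+1)%N -> (p < q)%N -> row_block l p = row_block l q ->
  [/\ p = (p.-1 %/ l * l + p.-1 %% l).+1, q = (p.-1 %% l * l + p.-1 %/ l).+1 &
    (p.-1 %/ l < p.-1 %% l)%N].
Proof.
case: q => // q lt_q; case: p => // p lt_pq [] /=.
have [l_gt0 lt1 lt2] := row_div erefl lt_q.
have [_ lt3 lt4] := row_div erefl (ltn_trans lt_pq lt_q).
have := divn_eq q l; have := divn_eq p l; rewrite /block.
move: lt1 lt2 lt3 lt4; set a := (q %/ l)%N; set b := (q %% l)%N.
set c := (p %/ l)%N; set d := (p %% l)%N => lt1 lt2 lt3 lt4 Ep Eq eq_b.
have eqd x y x' y' : (y < l)%N -> (y' < l)%N -> (x * l + y = x' * l + y')%N -> x = x' /\ y = y'.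
  move=> lt_y lt_y' eq_xy; split.
    by move/(congr1 (divn^~ l)): eq_xy; rewrite !divnMDl // !divn_small // !addn0.
  by move/(congr1 (modn^~ l)): eq_xy; rewrite !modnMDl !modn_small.
move: eq_b; case: ifP => lt_cd; case: ifP => lt_ab /eqd [] //.
- by move=> Ea Eb; move: lt_pq; rewrite Ep Eq Ea Eb ltnn.
- by move=> Ea Eb; split=> //; congr _.+1; [exact: Ep|rewrite Eq Ea Eb].
(* Here p would be row (b, a) and q row (a, b) with a < b, against p < q. *)
- move=> Ea Eb; move: lt_pq; rewrite Ep Eq Ea Eb.
  have : (a * l + l <= b * l)%N by rewrite -mulSnr leq_mul2r lt_ab orbT.
  by lia.
- by move=> Ea Eb; move: lt_pq; rewrite Ep Eq Ea Eb ltnn.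
Qed.

(** After the factorization [sum_inv_sign], a row (i, j) with i < j contributes the adjacency of g i
    and g j by [sum_weight_first], and every other row contributes 1. *)
Lemma sum_row_weight (T : comPzRingType) (e : rel nat) (N m l n : nat)
    (g : nat -> nat) :
  (N < m)%N -> (l * l * (m * 2) < n)%N -> (forall i, (i < l)%N -> (g i < N)%N) ->
  \sum_(f : {ffun 'I_(l * l).+1 -> 'I_n})
    (\prod_(p < (l * l).+1) row_weight T e N m l g p (f p)) *~ inv_sign f =
  (\prod_(p < (l * l).+1) \prod_(q < (l * l).+1 | (p < q)%N && (row_block l p != row_block l q))
     Num.sg ((row_block l q)%:Z - (row_block l p)%:Z))%:~R *
  \prod_(i < l) \prod_(j < l) (if (i < j)%N then (e (g i) (g j))%:R else 1).
Proof.
move=> lt_Nm lt_n lt_g; have m_gt0 := leq_ltn_trans (leq0n N) lt_Nm.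
pose col_block (x : nat) := if x is y.+1 then (y %/ 2 %/ m).+1 else 0%N.
(* The first copy of the row's own vertex, which is the forced column of the second row of a
   block. *)
pose target (p : nat) : int := if p is q.+1 then
  ((block l (q %/ l)%N (q %% l)%N * m + g (q %/ l)%N) * 2).+1%:Z else 0.
have nz p q (x : 'I_n) : (p < (l * l).+1)%N -> p = q.+1 -> row_weight T e N m l g p x != 0 ->
    exists w s, [/\ x = ((block l (q %/ l)%N (q %% l)%N * m + w) * 2 + s).+1 :> nat,
    live e N (q %/ l)%N (q %% l)%N (block l (q %/ l)%N (q %% l)%N %/ l)%N
      (block l (q %/ l)%N (q %% l)%N %% l)%N w s (g (q %/ l)%N) &
    (w < m)%N && (s < 2)%N].
  move=> lt_p eq_p; have [_ lt1 lt2] := row_div eq_p lt_p; rewrite eq_p.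
  exact: weight_neq0.
rewrite (@sum_inv_sign _ _ _ (fun p x => row_weight T e N m l g p x) (fun p => row_block l p) col_block (fun p => target p)); first last.
- move=> p q x lt_pq eq_b; case Eq : (q : nat) => [|q'] nzq; first by rewrite Eq in lt_pq.
  have := ltn_ord q; rewrite Eq => lt_q.
  have [l_gt0 lt1 lt2] := row_div (erefl q'.+1) lt_q.
  have [w [s [-> lv _]]] := nz q'.+1 _ _ lt_q erefl nzq.
  have [_ ] := row_block_eq (ltn_ord q) lt_pq eq_b; rewrite Eq => -[Eq'] lt_p.
  have lt_pl : (p.-1 %/ l < l)%N.
    by case: (p : nat) lt_p (ltn_ord p) => [|p'] lt_p ltp; rewrite ?div0n //; case: (row_div erefl ltp).
  move: lv; rewrite /live.
  have Ei : (q' %/ l = p.-1 %% l)%N by rewrite Eq' divnMDl // divn_small // addn0.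
  have Ej : (q' %% l = p.-1 %/ l)%N by rewrite Eq' modnMDl modn_small.
  rewrite /target !{}Ei !{}Ej ltnNge ltnW //= => /and5P[_ _ /eqP-> /eqP<- _].
  by rewrite addn0.
- move=> p x; case Ep : (p : nat) => [|p'] nzp.
    by move: nzp; rewrite /=; case: (x : nat) => [|y] //; rewrite eqxx.
  have := ltn_ord p; rewrite Ep => lt_p.
  have [w [s [-> _ /andP[lt_w lt_s]]]] := nz p'.+1 _ _ lt_p erefl nzp.
  by rewrite /= divnMDl // (divn_small lt_s) addn0 divnMDl // (divn_small lt_w) addn0.
- by case=> [|x] [|y] //= le_xy; rewrite ltnS !leq_div2r.
congr (_ * _); rewrite big_ord_recl /=.
(* The initial row takes column 0 and shares its block with no other row. *)
have noq0 : \sum_(x < n) (x == 0%N :> nat)%:R *~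
    (\prod_(q < (l * l).+1 | (0 < q)%N && (0%N == row_block l q)) Num.sg (target q - x%:Z)) = 1 :> T.
  have n_gt0 := leq_ltn_trans (leq0n _) lt_n.
  rewrite (bigD1 (Ordinal n_gt0)) //= [X in _ *~ X]big1 => [|q]; last first.
    by case: (q : nat).
  rewrite big1 ?addr0 // => x; rewrite -val_eqE /= => /negPf->.
  by rewrite mul0rz.
rewrite noq0 mul1r.
pose F p : T := \sum_(x < n) row_weight T e N m l g p.+1 x *~
  (\prod_(q < (l * l).+1 | (p.+1 < q)%N && (row_block l p.+1 == row_block l q)) Num.sg (target q - x%:Z)).
rewrite (eq_bigr (fun p : 'I_(l * l) => F p)); last first.
  by move=> p _; apply: eq_bigr => x _; rewrite /= /bump leq0n add1n.
rewrite big_ord_mul; apply: eq_bigr => i _; apply: eq_bigr => j _.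
have l_gt0 := leq_ltn_trans (leq0n i) (ltn_ord i).
have Ei : ((i * l + j) %/ l = i)%N by rewrite divnMDl // divn_small // addn0.
have Ej : ((i * l + j) %% l = j)%N by rewrite modnMDl modn_small.
have lt_ij (a b : 'I_l) : (a * l + b < l * l)%N by have := ltn_ord a; have := ltn_ord b; nia.
rewrite /F [LHS](eq_bigr (fun x : 'I_n => weight T e N m l i j x (g i) *~
  (if (i < j)%N then Num.sg (((block l i j * m + g j) * 2).+1%:Z - x%:Z) else 1))) => [|x _].
  case: ifP => lt; first by rewrite sum_weight_first // (ltn_trans _ lt_Nm) // lt_g.
  rewrite (eq_bigr (fun x : 'I_n => weight T e N m l i j x (g i))) => [|x _]; last by rewrite mulr1z.
  by rewrite sum_weight_last // ?lt_g // leqNgt lt.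
rewrite [row_weight _ _ _ _ _ _ _ _]/= Ei Ej; congr (_ *~ _).
(* The only later row in the block of (i, j) is (j, i), and only if i < j. *)
have same (q : 'I_(l * l).+1) : (((i * l + j).+1 < q) && (row_block l (i * l + j).+1 == row_block l q))%N =
    (i < j)%N && (q == (j * l + i).+1 :> nat).
  apply/andP/andP => [[lt_q /eqP eq_b]|[lt /eqP->]].
    have [_ Eq lt] := row_block_eq (ltn_ord q) lt_q eq_b.
    by move: Eq lt; rewrite /= Ei Ej => -> ->.
  have Ei' : ((j * l + i) %/ l = j)%N by rewrite divnMDl // divn_small // addn0.
  have Ej' : ((j * l + i) %% l = i)%N by rewrite modnMDl modn_small.
  have ge_ji : (j < i)%N = false by rewrite ltnNge ltnW.
  rewrite /row_block Ei Ej Ei' Ej' /block lt ge_ji; split=> //.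
  have : (i * l + l <= j * l)%N by rewrite -mulSnr leq_mul2r lt orbT.
  by have := ltn_ord j; lia.
rewrite (eq_bigl _ _ same); case: ifP => lt; last by rewrite big_pred0.
have lt_q : ((j * l + i).+1 < (l * l).+1)%N by rewrite ltnS.
rewrite (big_pred1 (Ordinal lt_q)) => [|q]; last by [].
have Ei' : ((j * l + i) %/ l = j)%N by rewrite divnMDl // divn_small // addn0.
have Ej' : ((j * l + i) %% l = i)%N by rewrite modnMDl modn_small.
have ge_ji : (j < i)%N = false by rewrite ltnNge ltnW.
by rewrite /= Ei' Ej' /block lt ge_ji.
Qed.
Definition gates (T : comPzRingType) (e : rel nat) (N m l d n : nat) :
    'M['M[T]_d]_((l * l).+1, n) :=
  \matrix_(p, c)
    if nat_of_ord p is q.+1 then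
      gate m ((q %% l).+1 == l)%N (fun u => weight T e N m l (q %/ l) (q %% l) c u)
    else if c == 0%N :> nat then jump T m d else 0.

(** Eliminates the phantom state N and the padding states: edges start below N, and the other rows
    require u < N explicitly. *)
Lemma weight_ge (T : comPzRingType) (e : rel nat) (N m l i j c u : nat) :
  (forall u w, e u w -> u < N)%N -> (N <= u)%N -> weight T e N m l i j c u = 0.
Proof.
move=> e_lt le_Nu; case: c => [|x] //; rewrite /weight.
case: (boolP (live _ _ _ _ _ _ _ _ _)); last by rewrite mulr0.
rewrite /live; case: ifP => _ => [/and3P[_ _ /e_lt]|/and5P[_ _ _ _]];
  by rewrite ltnNge le_Nu.
Qed.

(** Distributivity turns the product of sums in [jump_gate_prod] into a sum over vertex sequences
    [g], which are extended by 0 to all indices. *)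
Lemma gates_prod (T : comPzRingType) (e : rel nat) (N l d n : nat)
    (f : 'I_(l * l).+1 -> 'I_n) (u : 'I_d) :
  (forall u w, e u w -> u < N)%N -> (N < d)%N -> u = 0%N :> nat ->
  (\prod_(p < (l * l).+1) gates T e N N.+1 l d n p (f p)) u u =
  \sum_(g : {ffun 'I_l -> 'I_N}) \prod_(p < (l * l).+1)
     row_weight T e N N.+1 l (fun i => if insub i is Some i' then g i' : nat else 0%N) p (f p).
Proof.
move=> e_lt lt_Nd u0.
pose F q : 'M[T]_d := gate N.+1 ((q %% l).+1 == l)%N
  (fun u => weight T e N N.+1 l (q %/ l) (q %% l) (f (inord q.+1)) u).
have liftE (p : 'I_(l * l)) : lift ord0 p = inord p.+1.
  by apply: ord_inj; rewrite lift0 inordK // ltnS.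
rewrite big_ord_recl (eq_bigr (fun p : 'I_(l * l) => F p)); last first.
  by move=> p _; rewrite mxE lift0 /F liftE.
rewrite [\prod_(i < l * l) _](big_ord_mul _ _ _ F).
have prodE : (jump T N.+1 d * \prod_(i < l) \prod_(j < l) F (i * l + j)%N) u u =
    \sum_(g : {ffun 'I_l -> 'I_N}) \prod_(i < l) \prod_(j < l)
      weight T e N N.+1 l i j (f (inord (i * l + j).+1)) (g i).
  have FE i j : (j < l)%N -> F (i * l + j)%N = gate N.+1 (j.+1 == l)
      (fun u : 'I_d => weight T e N N.+1 l i j (f (inord (i * l + j).+1)) u).
    move=> lt_j; have l_gt0 := leq_ltn_trans (leq0n j) lt_j.
    by rewrite /F divnMDl // divn_small // addn0 modnMDl modn_small.
  have -> : \prod_(i < l) \prod_(j < l) F (i * l + j)%N = \prod_(i < l) \prod_(j < l)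
      gate N.+1 (j.+1 == l)
       (fun u : 'I_d => weight T e N N.+1 l i j (f (inord (i * l + j).+1)) u).
    by apply: eq_bigr => i _; apply: eq_bigr => j _; apply: FE.
  have := jump_gate_prod l N.+1
    (fun i j (x : 'I_d) => weight T e N N.+1 l i j (f (inord (i * l + j).+1)) x) u u.
  move=> ->; rewrite u0 mul1r.
  rewrite -(bigA_distr_bigA (fun (i : 'I_l) (x : 'I_N) =>
    \prod_(j < l) weight T e N N.+1 l i j (f (inord (i * l + j).+1)) x)); apply: eq_bigr => i _.
  (* The state sum is cut down to the states 0, ..., N, and the phantom N is split off; its term
     vanishes because each group contains at least one row. *)
  rewrite -(big_ord_widen d (fun x => \prod_(j < l)
    weight T e N N.+1 l i j (f (inord (i * l + j).+1)) x) lt_Nd) big_ord_recr /=.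
  have l_gt0 := leq_ltn_trans (leq0n i) (ltn_ord i).
  rewrite [X in _ + X](bigD1 (Ordinal l_gt0)) //= [weight _ _ _ _ _ _ _ _ N](_ : _ = 0) ?mul0r ?addr0 //.
  by rewrite weight_ge.
have -> : gates T e N N.+1 l d n ord0 (f ord0) = if f ord0 == 0%N :> nat then jump T N.+1 d else 0.
  by rewrite mxE.
pose G (g : {ffun 'I_l -> 'I_N}) q : T :=
  row_weight T e N N.+1 l (fun i => if insub i is Some i' then g i' : nat else 0%N) q.+1 (f (inord q.+1)).
have rowE (g : {ffun 'I_l -> 'I_N}) : \prod_(p < (l * l).+1) row_weight T e N N.+1 l
    (fun i => if insub i is Some i' then g i' : nat else 0%N) p (f p) =
    (f ord0 == 0%N :> nat)%:R * \prod_(q < l * l) G g q.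
  by rewrite big_ord_recl; congr (_ * _); apply: eq_bigr => q _; rewrite lift0 liftE.
rewrite (eq_bigr _ (fun g _ => rowE g)); case: (_ == _); last first.
  by rewrite mul0r mxE big1 // => g _; rewrite mul0r.
rewrite prodE; apply: eq_bigr => g _; rewrite mul1r big_ord_mul.
apply: eq_bigr => i _; apply: eq_bigr => j _.
have l_gt0 := leq_ltn_trans (leq0n j) (ltn_ord j).
by rewrite /G /= divnMDl // divn_small // addn0 modnMDl modn_small // valK.
Qed.

(** The sign comes from pairs of rows in different blocks and is the same for every [g], so the
    contributions of different sequences cannot cancel. *)
Lemma rdet_gates (T : comPzRingType) (e : rel nat) (N l d n : nat) (u : 'I_d) :
  (forall u w, e u w -> u < N)%N -> (N < d)%N -> u = 0%N :> nat ->
  (l * l * (N.+1 * 2) < n)%N ->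
  exists b : bool, rdet (gates T e N N.+1 l d n) u u =
    (-1) ^+ b * #|[set g : {ffun 'I_l -> 'I_N} |
      [forall i : 'I_l, forall j : 'I_l, (i < j)%N ==> e (g i) (g j)]]|%:R.
Proof.
move=> e_lt lt_Nd u0 lt_n.
pose z : int := \prod_(p < (l * l).+1)
  \prod_(q < (l * l).+1 | (p < q)%N && (row_block l p != row_block l q))
     Num.sg ((row_block l q)%:Z - (row_block l p)%:Z).
have [b zE] : exists b : bool, z = (-1) ^+ b.
  apply: (big_ind (fun z => exists b : bool, z = (-1) ^+ b)); first by exists false.
    by move=> _ _ [b ->] [b' ->]; exists (b (+) b'); rewrite signr_addb.
  move=> p _; apply: (big_ind (fun z => exists b : bool, z = (-1) ^+ b)); first by exists false.
    by move=> _ _ [b ->] [b' ->]; exists (b (+) b'); rewrite signr_addb.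
  move=> q /andP[_ neq_b]; exists (row_block l q < row_block l p)%N.
  case: (ltngtP (row_block l q) (row_block l p)) neq_b => [lt|lt|->].
  - by rewrite ltr0_sg // subr_lt0 ltz_nat.
  - by rewrite gtr0_sg // subr_gt0 ltz_nat.
  - by [].
exists b; rewrite rdetE summxE.
have G_lt (g : {ffun 'I_l -> 'I_N}) i : (i < l)%N ->
    ((if insub i is Some i' then g i' : nat else 0) < N)%N.
  by move=> lt_i; rewrite insubT.
rewrite (eq_bigr (fun f : {ffun 'I_(l * l).+1 -> 'I_n} =>
  \sum_(g : {ffun 'I_l -> 'I_N}) (\prod_(p < (l * l).+1) row_weight T e N N.+1 l
    (fun i => if insub i is Some i' then g i' : nat else 0%N) p (f p)) *~ inv_sign f)); last first.
  move=> f _; rewrite -scaler_int mxE gates_prod // mulr_sumr.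
  by apply: eq_bigr => g _; rewrite mulrzl.
rewrite exchange_big /= (eq_bigr (fun g : {ffun 'I_l -> 'I_N} =>
   (-1) ^+ b * ([forall i : 'I_l, forall j : 'I_l, (i < j)%N ==> e (g i) (g j)])%:R)); last first.
  move=> g _; rewrite sum_row_weight // -?/z ?zE ?rmorph_sign //; last by move=> i; apply: G_lt.
  congr (_ * _).
  case: (boolP [forall i, _]) => [/forallP g_e|].
    apply: big1 => i _; apply: big1 => j _; case: ifP => // lt_ij.
    by have /forallP/(_ j) := g_e i; rewrite lt_ij /= !valK => ->.
  rewrite negb_forall => /existsP[i]; rewrite negb_forall => /existsP[j].
  rewrite negb_imply => /andP[lt_ij /negPf ne].
  by rewrite (bigD1 i) //= [X in X * _](bigD1 j) //= lt_ij !valK ne !mul0r.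
rewrite -mulr_sumr -sum1_card natr_sum [in RHS]big_mkcond /=; congr (_ * _).
by apply: eq_bigr => g _; rewrite inE; case: ifP.
Qed.

(** * Cliques as increasing vertex sequences *)

Local Open Scope nat_scope.

(** The orientation makes each clique correspond to exactly one sequence, its increasing
    enumeration. *)
Definition up_edge (x : tree) : rel nat := fun u w => adj x u w && (u < w).

Lemma up_edge_lt (x : tree) (u w : nat) : up_edge x u w -> u < dec_unary x.
Proof.
case/andP=> /and3P[_ + _] _; rewrite ltnNge; apply: contraL => le_xu.
by rewrite {2}/entry nth_default //= /entry nth_nil.
Qed.

(** The value lists are strictly sorted and have the same elements, hence are equal. *)
Lemma mono_ffun_inj (k n : nat) (f g : {ffun 'I_k -> 'I_n}) :
  {homo f : i j / i < j} -> {homo g : i j / i < j} -> f @: 'I_k = g @: 'I_k -> f = g.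
Proof.
move=> f_mono g_mono eq_im.
have sort_h (h : {ffun 'I_k -> 'I_n}) : {homo h : i j / i < j} ->
    sorted (relpre val ltn) (map h (enum 'I_k)).
  move=> h_mono; rewrite sorted_map; apply: (@sub_sorted _ (relpre val ltn)).
    by move=> i j; apply: h_mono.
  by rewrite -sorted_map val_enum_ord iota_ltn_sorted.
have /eq_in_map eq_fg : map f (enum 'I_k) = map g (enum 'I_k).
  apply: (@irr_sorted_eq _ (relpre val ltn)) => //; try exact: sort_h.
  - by move=> x y z; apply: ltn_trans.
  - by move=> x; apply: ltnn.
  have memE (h : {ffun 'I_k -> 'I_n}) x : (x \in map h (enum 'I_k)) = (x \in h @: 'I_k).
    by apply/mapP/imsetP => -[i _ ->]; exists i; rewrite ?mem_enum.
  by move=> x; rewrite !memE eq_im.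
by apply/ffunP => i; apply: eq_fg; rewrite mem_enum.
Qed.

(** Taking images is injective on increasing sequences by [mono_ffun_inj], and [enum_fun] gives a
    preimage of each clique. *)
Lemma sharp_cliqueE (x : tree) (l : nat) :
  sharp_clique x l = #|[set g : {ffun 'I_l -> 'I_(dec_unary x)} |
    [forall i : 'I_l, forall j : 'I_l, (i < j) ==> up_edge x (g i) (g j)]]|.
Proof.
set P := [set g | _]; have edge g (i j : 'I_l) : g \in P -> i < j -> up_edge x (g i) (g j).
  by rewrite inE => /forallP/(_ i)/forallP/(_ j)/implyP.
have mono g : g \in P -> {homo g : i j / i < j}.
  by move=> Pg i j /(edge _ _ _ Pg)/andP[].
have inj g : g \in P -> injective g.
  move=> /mono g_mono i j eq_g; case: (ltngtP i j) => [|/g_mono|/ord_inj] //.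
    by move/g_mono; rewrite eq_g ltnn.
  by rewrite eq_g ltnn.
rewrite -(@card_in_imset _ _ (fun g : {ffun 'I_l -> _} => g @: 'I_l) P); last first.
  by move=> f g /mono f_mono /mono g_mono; apply: mono_ffun_inj.
apply: eq_card => S; rewrite inE; apply/andP/imsetP => [[cardS clS]|[g Pg ->]]; last first.
  split; first by rewrite card_imset ?card_ord //; apply: inj.
  apply/forall_inP => _ /imsetP[i _ ->]; apply/forall_inP => _ /imsetP[j _ ->].
  apply/implyP => neq_g; case: (ltngtP i j) => [lt_ij|lt_ji|/ord_inj eq_ij].
  - by case/andP: (edge _ _ _ Pg lt_ij).
  - case/andP: (edge _ _ _ Pg lt_ji) => /and3P[_ e1 e2] _.
    by rewrite /adj e1 e2 !andbT.
  - by rewrite eq_ij eqxx in neq_g.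
pose T : {S : {set 'I_(dec_unary x)} | #|S| == l} := Sub S cardS.
exists [ffun i => enum_fun T i]; last first.
  rewrite -[S]/(val T) -(imset_enum_fun T 1).
  by apply: eq_imset => i; rewrite !ffunE perm1.
rewrite inE; apply/forallP => i; apply/forallP => j; apply/implyP => lt_ij.
have lt_T := @enum_fun_mono _ _ T i j lt_ij; rewrite !ffunE /up_edge lt_T andbT.
have memT k : enum_fun T k \in S by apply: enum_valP.
have /forall_inP/(_ _ (memT i))/forall_inP/(_ _ (memT j))/implyP := clS; apply.
by apply: contraTneq lt_T => ->; rewrite ltnn.
Qed.

(** * Polynomial-time functions on trees *)

Lemma dec_seqK : cancel dec_seq enc_seq.
Proof. by elim=> //= l _ r ->. Qed.

Lemma tsize_gt0 (x : tree) : 0 < tsize x.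
Proof. by case: x. Qed.

Lemma tsize_hd (x : tree) : tsize (hd x) <= tsize x.
Proof. by case: x => //= l r; lia. Qed.

Lemma tsize_tl (x : tree) : tsize (tl x) <= tsize x.
Proof. by case: x => //= l r; lia. Qed.

Lemma size_dec_seq (x : tree) : size (dec_seq x) <= tsize x.
Proof. by elim: x => //= l _ r IH; lia. Qed.

(** Time charges the size of every stored value, so a variable grows by at most the elapsed time.
    This turns time bounds into size bounds. *)
Lemma exec_tsize (O : tree -> tree) (c : cmd) (s s' : store) (t : nat) (qs : seq tree) :
  exec O c s s' t qs -> forall v, tsize (s' v) <= tsize (s v) + t.
Proof.
elim=> {c s s' t qs} /=.
- by move=> v e s w; rewrite /upd; case: eqP => _; lia.
- by move=> v e s w; rewrite /upd; case: eqP => _; lia.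
- by move=> c1 c2 s s1 s2 t1 t2 qs1 qs2 _ IH1 _ IH2 v; have := IH1 v; have := IH2 v; lia.
- by move=> e c1 c2 s s' t qs _ _ IH v; have := IH v; lia.
- by move=> e c1 c2 s s' t qs _ _ IH v; have := IH v; lia.
- by move=> e c s s1 s2 t1 t2 qs1 qs2 _ _ IH1 _ IH2 v; have := IH1 v; have := IH2 v; lia.
- by move=> e c s _ v; lia.
Qed.

(* The base is at least 2, so that the exponent also absorbs constant factors. *)
Definition pbound (T : tree -> nat) : Prop :=
  exists C, forall x, T x <= (tsize x).+1 ^ C.

Lemma pbound_le (T T' : tree -> nat) :
  (forall x, T x <= T' x) -> pbound T' -> pbound T.
Proof. by move=> le_T [C leC]; exists C => x; apply: leq_trans (leC x). Qed.

Lemma pbound_const (k : nat) : pbound (fun=> k).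
Proof.
exists k => x; apply: leq_trans (ltnW (ltn_expl k (ltnSn 1))) _.
by case: k => // k; rewrite leq_exp2r // ltnS tsize_gt0.
Qed.

Lemma pbound_tsize : pbound (fun x => tsize x).
Proof. by exists 1 => x; rewrite expn1 leqnSn. Qed.

Lemma leq_expl (e : nat) : {homo expn^~ e : m n / m <= n}.
Proof. by case: e => [|e] m n le_mn; rewrite ?expn0 // leq_exp2r. Qed.

Lemma leq_expD (b i j : nat) : 0 < b -> b ^ i <= b ^ (i + j).
Proof. by move=> b_gt0; rewrite expnD leq_pmulr // expn_gt0 b_gt0. Qed.

Lemma pboundM (T T' : tree -> nat) :
  pbound T -> pbound T' -> pbound (fun x => T x * T' x).
Proof. by move=> [C leC] [D leD]; exists (C + D) => x; rewrite expnD leq_mul. Qed.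

Lemma pboundD (T T' : tree -> nat) :
  pbound T -> pbound T' -> pbound (fun x => T x + T' x).
Proof.
move=> [C leC] [D leD]; exists (C + D).+1 => x; rewrite expnS.
have b_gt1 : 1 < (tsize x).+1 by rewrite ltnS tsize_gt0.
apply: leq_trans (leq_mul b_gt1 (leqnn _)).
rewrite mul2n -addnn leq_add // (leq_trans (leC x), leq_trans (leD x)) //.
  exact: leq_expD.
by rewrite addnC leq_expD.
Qed.

Lemma pboundX (T : tree -> nat) (k : nat) : pbound T -> pbound (fun x => T x ^ k).
Proof.
move=> pT; elim: k => [|k IHk]; first exact: pbound_const 1.
by apply: pbound_le (pboundM pT IHk) => x; rewrite expnS.
Qed.

Lemma pbound_comp (T : tree -> nat) (f : tree -> tree) :
  pbound T -> pbound (fun x => tsize (f x)) -> pbound (fun x => T (f x)).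
Proof.
move=> [C leC] pf; apply: (pbound_le (fun x => leC (f x))); apply: pboundX.
by apply: pbound_le (pboundD (pbound_const 1) pf) => x.
Qed.

(* [c n] works in place on the variable n, may start with garbage in the variables
   above it, and preserves those below. *)
Definition polytime (f : tree -> tree) : Prop :=
  exists T c, pbound T /\ forall O n s, exists s' t,
    [/\ exec O (c n) s s' t [::], s' n = f (s n),
        forall v, v < n -> s' v = s v & t <= T (s n)].

Lemma polytime_size (f : tree -> tree) : polytime f -> pbound (fun x => tsize (f x)).
Proof.
move=> [T [c [pT cP]]]; apply: pbound_le (pboundD pbound_tsize pT) => x.
have [s' [t [e fE _ le_t]]] := cP (fun=> Nil) 0 (fun=> x).
by rewrite -fE (leq_trans (exec_tsize e 0)) // leq_add2l.
Qed.

Lemma polytime_ext (f g : tree -> tree) : (forall x, f x = g x) -> polytime f -> polytime g.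
Proof.
move=> eq_fg [T [c [pT cP]]]; exists T, c; split=> // O n s.
by have [s' [t []]] := cP O n s; rewrite eq_fg; exists s', t.
Qed.

Lemma polytime_id : polytime id.
Proof.
exists (fun x => tsize x), (fun n => Assign n (EVar n)); split; first exact: pbound_tsize.
move=> O n s; exists (upd s n (s n)), (tsize (s n)).
split=> //; first exact: (XAssign O n (EVar n) s).
  by rewrite /upd eqxx.
by move=> v lt_v; rewrite /upd ltn_eqF.
Qed.

Lemma polytime_comp (g f : tree -> tree) :
  polytime g -> polytime f -> polytime (fun x => g (f x)).
Proof.
move=> [Tg [cg [pg cgP]]] pf; have szf := polytime_size pf.
have [Tf [cf [pTf cfP]]] := pf.
exists (fun x => Tf x + Tg (f x)), (fun n => Seq (cf n) (cg n)).
split; first by apply: pboundD => //; apply: pbound_comp.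
move=> O n s; have [s1 [t1 [e1 v1 k1 b1]]] := cfP O n s.
have [s2 [t2 [e2 v2 k2 b2]]] := cgP O n s1.
exists s2, (t1 + t2); split; first exact: (XSeq e1 e2).
- by rewrite v2 v1.
- by move=> v lt_v; rewrite k2 // k1.
- by rewrite -v1 leq_add.
Qed.

Lemma polytime_hd (f : tree -> tree) : polytime f -> polytime (fun x => hd (f x)).
Proof.
apply: polytime_comp; exists (fun x => tsize x), (fun n => Assign n (EHd (EVar n))).
split; first exact: pbound_tsize.
move=> O n s; exists (upd s n (hd (s n))), (tsize (hd (s n))).
split; [exact: (XAssign O n (EHd (EVar n)) s)|by rewrite /upd eqxx| |exact: tsize_hd].
by move=> v lt_v; rewrite /upd ltn_eqF.
Qed.

Lemma polytime_tl (f : tree -> tree) : polytime f -> polytime (fun x => tl (f x)).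
Proof.
apply: polytime_comp; exists (fun x => tsize x), (fun n => Assign n (ETl (EVar n))).
split; first exact: pbound_tsize.
move=> O n s; exists (upd s n (tl (s n))), (tsize (tl (s n))).
split; [exact: (XAssign O n (ETl (EVar n)) s)|by rewrite /upd eqxx| |exact: tsize_tl].
by move=> v lt_v; rewrite /upd ltn_eqF.
Qed.

Lemma polytime_nil : polytime (fun=> Nil).
Proof.
exists (fun=> 1), (fun n => Assign n ENil); split; first exact: pbound_const.
move=> O n s; exists (upd s n Nil), 1.
split=> //; first exact: (XAssign O n ENil s); first by rewrite /upd eqxx.
by move=> v lt_v; rewrite /upd ltn_eqF.
Qed.

Lemma polytime_cons (f g : tree -> tree) :
  polytime f -> polytime g -> polytime (fun x => Cons (f x) (g x)).
Proof.
move=> pf pg; have szf := polytime_size pf; have szg := polytime_size pg.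
have [Tf [cf [pTf cfP]]] := pf; have [Tg [cg [pTg cgP]]] := pg.
exists (fun x => tsize x + (Tf x + (tsize x + (Tg x + (1 + tsize (f x) + tsize (g x)))))).
(* Programs overwrite their input, so [cf] and [cg] run on copies, each placed above the values that
   are still needed. *)
exists (fun n => Seq (Assign n.+1 (EVar n)) (Seq (cf n.+1) (Seq (Assign n.+2 (EVar n))
  (Seq (cg n.+2) (Assign n (ECons (EVar n.+1) (EVar n.+2))))))).
split; first by do !apply: pboundD => //; [exact: pbound_tsize|exact: pbound_tsize|exact: pbound_const].
move=> O n s.
have [s1 [t1 [e1 v1 k1 b1]]] := cfP O n.+1 (upd s n.+1 (s n)).
have [s2 [t2 [e2 v2 k2 b2]]] := cgP O n.+2 (upd s1 n.+2 (s1 n)).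
have s1n : s1 n = s n by rewrite k1 // /upd ltn_eqF.
have v1' : s1 n.+1 = f (s n) by rewrite v1 /upd eqxx.
have v2' : s2 n.+2 = g (s n) by rewrite v2 /upd eqxx s1n.
have v2'' : s2 n.+1 = f (s n) by rewrite k2 // /upd ltn_eqF.
exists (upd s2 n (Cons (f (s n)) (g (s n)))).
exists (tsize (s n) + (t1 + (tsize (s1 n) + (t2 + tsize (Cons (f (s n)) (g (s n))))))).
split.
- apply: (@XSeq _ _ _ _ _ _ _ _ [::] [::]); first exact: (XAssign O n.+1 (EVar n) s).
  apply: (@XSeq _ _ _ _ _ _ _ _ [::] [::]); first exact: e1.
  apply: (@XSeq _ _ _ _ _ _ _ _ [::] [::]); first exact: (XAssign O n.+2 (EVar n) s1).
  apply: (@XSeq _ _ _ _ _ _ _ _ [::] [::]); first exact: e2.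
  by have := XAssign O n (ECons (EVar n.+1) (EVar n.+2)) s2; rewrite /= v2' v2''.
- by rewrite /upd eqxx.
- move=> v lt_v; rewrite /upd ltn_eqF // k2 ?(ltn_trans lt_v) //.
  rewrite /upd ltn_eqF ?(ltn_trans lt_v) // k1 ?(ltn_trans lt_v) //.
  by rewrite /upd ltn_eqF ?(ltn_trans lt_v).
- rewrite s1n /=; move: b1 b2; rewrite /upd !eqxx s1n => b1 b2.
  by lia.
Qed.

Lemma polytime_if (b f g : tree -> tree) :
  polytime b -> polytime f -> polytime g ->
  polytime (fun x => if is_cons (b x) then f x else g x).
Proof.
move=> pb pf pg.
have [Tb [cb [pTb cbP]]] := pb; have [Tf [cf [pTf cfP]]] := pf; have [Tg [cg [pTg cgP]]] := pg.
exists (fun x => tsize x + (Tb x + (1 + (Tf x + Tg x)))).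
exists (fun n => Seq (Assign n.+1 (EVar n)) (Seq (cb n.+1) (If (EVar n.+1) (cf n) (cg n)))).
split; first by do !apply: pboundD => //; [exact: pbound_tsize|exact: pbound_const].
move=> O n s.
have [s1 [t1 [e1 v1 k1 b1]]] := cbP O n.+1 (upd s n.+1 (s n)).
have s1n : s1 n = s n by rewrite k1 // /upd ltn_eqF.
have v1' : s1 n.+1 = b (s n) by rewrite v1 /upd eqxx.
have k1' v : v < n -> s1 v = s v.
  by move=> lt_v; rewrite k1 ?(ltn_trans lt_v) // /upd ltn_eqF ?(ltn_trans lt_v).
move: b1; rewrite /upd eqxx => b1.
have [s2 [t2 [e2 v2 k2 b2]]] : exists s2 t2, [/\ exec O (If (EVar n.+1) (cf n) (cg n)) s1 s2 t2 [::],
   s2 n = (if is_cons (b (s n)) then f (s n) else g (s n)), forall v, v < n -> s2 v = s1 v &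
   t2 <= 1 + (Tf (s n) + Tg (s n))].
  case: ifP => bE.
    have [s2 [t2 [e2 v2 k2 b2]]] := cfP O n s1; exists s2, t2.+1; split=> //; last by move: b2; rewrite s1n; lia.
      by apply: XIfTrue => //=; rewrite v1'.
    by rewrite v2 s1n.
  have [s2 [t2 [e2 v2 k2 b2]]] := cgP O n s1; exists s2, t2.+1; split=> //; last by move: b2; rewrite s1n; lia.
    by apply: XIfFalse => //=; rewrite v1' bE.
  by rewrite v2 s1n.
exists s2, (tsize (s n) + (t1 + t2)); split=> //; last by lia.
  apply: (@XSeq _ _ _ _ _ _ _ _ [::] [::]); first exact: (XAssign O n.+1 (EVar n) s).
  exact: (@XSeq _ _ _ _ _ _ _ _ [::] [::] e1 e2).
by move=> v lt_v; rewrite k2 // k1'.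
Qed.
(** Variable n holds x, n.+1 the rest of the list, n.+2 the accumulator and n.+3 the argument of the
    body. B bounds every partial fold, since iterating a polynomial-time body could otherwise
    produce exponentially large trees. *)
Lemma exec_foldl (O : tree -> tree) (n : nat) (c : cmd) (T : nat -> nat)
    (h : tree -> tree -> tree) (x : tree) (B S : nat) :
  {homo T : i j / i <= j} ->
  (forall s a acc, s n = x -> s n.+3 = Cons a (Cons acc x) -> exists s' t,
    [/\ exec O c s s' t [::], s' n.+3 = h acc a, forall v, v < n.+3 -> s' v = s v &
        t <= T (tsize (s n.+3))]) ->
  forall l s, s n = x -> s n.+1 = enc_seq l -> tsize (enc_seq l) <= S ->
  (forall k, tsize (foldl h (s n.+2) (take k l)) <= B) ->
  exists s' t, [/\ exec O (While (EVar n.+1)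
      (Seq (Assign n.+3 (ECons (EHd (EVar n.+1)) (ECons (EVar n.+2) (EVar n))))
      (Seq c (Seq (Assign n.+2 (EVar n.+3)) (Assign n.+1 (ETl (EVar n.+1))))))) s s' t [::],
    s' n.+2 = foldl h (s n.+2) l, forall v, v <= n -> s' v = s v &
    t <= size l * (S + B + tsize x + T (S + B + tsize x).+2 + B + S).+3 + 1].
Proof.
move=> T_mono cP; elim=> [|a l IH] s sn sl leS leB.
  exists s, 1; split=> //; apply: XWhileFalse; by rewrite /= sl.
pose s1 := upd s n.+3 (Cons a (Cons (s n.+2) x)).
have s1k v : v < n.+3 -> s1 v = s v by move=> lt_v; rewrite /s1 /upd ltn_eqF.
have s1v : s1 n.+3 = Cons a (Cons (s n.+2) x) by rewrite /s1 /upd eqxx.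
have [s2 [t2 [e2 v2 k2 b2]]] := cP s1 a (s n.+2) (etrans (s1k n ltac:(lia)) sn) s1v.
have s2k v : v < n.+3 -> s2 v = s v by move=> lt_v; rewrite k2 // s1k.
pose s3 := upd s2 n.+2 (h (s n.+2) a).
have s3k v : v < n.+2 -> s3 v = s v.
  by move=> lt_v; rewrite /s3 /upd ltn_eqF // s2k // (ltn_trans lt_v).
pose s4 := upd s3 n.+1 (enc_seq l).
have s4k v : v < n.+1 -> s4 v = s v.
  by move=> lt_v; rewrite /s4 /upd ltn_eqF // s3k // (ltn_trans lt_v).
have s4a : s4 n.+2 = h (s n.+2) a by rewrite /s4 /upd gtn_eqF // /s3 /upd eqxx.
have s4l : s4 n.+1 = enc_seq l by rewrite /s4 /upd eqxx.
have leS' : tsize (enc_seq l) <= S by move: leS => /=; lia.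
have [||s5 [t5 [e5 v5 k5 b5]]] := IH s4 _ s4l leS'.
- by rewrite s4k.
- by move=> k; rewrite s4a; apply: (leB k.+1).
pose t1 := tsize (Cons a (Cons (s n.+2) x)).
exists s5, ((t1 + (t2 + (tsize (h (s n.+2) a) + tsize (enc_seq l)))) + t5).+1; split.
- apply: (@XWhileTrue _ _ _ _ _ _ _ _ [::] [::] _ _ e5); first by rewrite /= sl.
  apply: (@XSeq _ _ _ _ _ _ _ _ [::] [::]).
    have := XAssign O n.+3 (ECons (EHd (EVar n.+1)) (ECons (EVar n.+2) (EVar n))) s.
    by rewrite /= sl sn; apply.
  apply: (@XSeq _ _ _ _ _ _ _ _ [::] [::] e2).
  apply: (@XSeq _ _ _ _ _ _ _ _ [::] [::]).
    by have := XAssign O n.+2 (EVar n.+3) s2; rewrite /= v2; apply.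
  have := XAssign O n.+1 (ETl (EVar n.+1)) s3.
  by rewrite /= s3k // sl; apply.
- by rewrite v5 s4a.
- by move=> v le_v; rewrite k5 // s4k.
- have le_acc := leB 0; rewrite take0 /= in le_acc.
  have le_acc' := leB 1; rewrite /= take0 /= in le_acc'.
  have le1 : t1 <= (S + B + tsize x).+2 by rewrite /t1 /=; move: leS => /=; lia.
  have le2 : t2 <= T (S + B + tsize x).+2.
    by apply: leq_trans b2 _; apply: T_mono; rewrite s1v.
  rewrite mulSn; move: b5 le1 le2 le_acc' leS'; set Z := size l * _; clear.
  by lia.
Qed.

Lemma polytime_foldl (g ini lst : tree -> tree) (B : tree -> nat) :
  polytime g -> polytime ini -> polytime lst -> pbound B ->
  (forall x k, tsize (foldl (fun acc a => g (Cons a (Cons acc x))) (ini x)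
     (take k (dec_seq (lst x)))) <= B x) ->
  polytime (fun x => foldl (fun acc a => g (Cons a (Cons acc x))) (ini x) (dec_seq (lst x))).
Proof.
move=> [Tg [cg [[C leC] cgP]]] pi pl pB leB.
have szl := polytime_size pl.
have [Ti [ci [pTi ciP]]] := pi; have [Tl [cl [pTl clP]]] := pl.
(* [exec_foldl] wants a monotone bound in the size alone, so [Tg] is replaced by its polynomial
   majorant. *)
pose T k := k.+1 ^ C.
exists (fun x => tsize x + (Tl x + (tsize x + (Ti x +
  ((tsize (lst x) * (3 + (tsize (lst x) + B x + tsize x +
     (3 + (tsize (lst x) + B x + tsize x)) ^ C + B x + tsize (lst x))) + 1) + B x))))).
exists (fun n => Seq (Assign n.+1 (EVar n)) (Seq (cl n.+1) (Seq (Assign n.+2 (EVar n))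
  (Seq (ci n.+2) (Seq (While (EVar n.+1)
      (Seq (Assign n.+3 (ECons (EHd (EVar n.+1)) (ECons (EVar n.+2) (EVar n))))
      (Seq (cg n.+3) (Seq (Assign n.+2 (EVar n.+3)) (Assign n.+1 (ETl (EVar n.+1)))))))
      (Assign n (EVar n.+2))))))).
split.
  have ? := pbound_tsize; have ? := pbound_const.
  by repeat first [apply: pboundX | apply: pboundD | apply: pboundM | done | exact: pbound_const].
move=> O n s.
have [s1 [t1 [e1 v1 k1 b1]]] := clP O n.+1 (upd s n.+1 (s n)).
have [s2 [t2 [e2 v2 k2 b2]]] := ciP O n.+2 (upd s1 n.+2 (s1 n)).
have s1n : s1 n = s n by rewrite k1 // /upd ltn_eqF.
have v1' : s1 n.+1 = lst (s n) by rewrite v1 /upd eqxx.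
have v2' : s2 n.+2 = ini (s n) by rewrite v2 /upd eqxx s1n.
have v2'' : s2 n.+1 = enc_seq (dec_seq (lst (s n))) by rewrite dec_seqK k2 // /upd ltn_eqF.
have lt_n2 : n < n.+2 by rewrite ltnS leqnSn.
have s2n : s2 n = s n by rewrite k2 // /upd ltn_eqF.
have Tmono : {homo T : i j / i <= j} by move=> i j le_ij; rewrite /T leq_expl.
have [|||s3 [t3 [e3 v3 k3 b3]]] := @exec_foldl O n (cg n.+3) T
  (fun acc a => g (Cons a (Cons acc (s n)))) (s n) (B (s n)) (tsize (lst (s n))) Tmono _ _ s2 s2n v2'' _ _.
- move=> s' a acc _ E; have [s'' [t [e v k b]]] := cgP O n.+3 s'.
  by exists s'', t; split=> //; [rewrite v E|exact: leq_trans b (leC _)].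
- by rewrite dec_seqK.
- by move=> k; rewrite v2'; apply: leB.
exists (upd s3 n (s3 n.+2)).
exists (tsize (s n) + (t1 + (tsize (s1 n) + (t2 + (t3 + tsize (s3 n.+2)))))); split.
- apply: (@XSeq _ _ _ _ _ _ _ _ [::] [::]); first exact: (XAssign O n.+1 (EVar n) s).
  apply: (@XSeq _ _ _ _ _ _ _ _ [::] [::] e1).
  apply: (@XSeq _ _ _ _ _ _ _ _ [::] [::]); first exact: (XAssign O n.+2 (EVar n) s1).
  apply: (@XSeq _ _ _ _ _ _ _ _ [::] [::] e2).
  apply: (@XSeq _ _ _ _ _ _ _ _ [::] [::] e3).
  exact: (XAssign O n (EVar n.+2) s3).
- by rewrite /upd eqxx v3 v2'.
- move=> v lt_v; have lt1 := ltnW lt_v; have lt2 := leqW lt1; have lt3 := leqW lt2.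
  rewrite /upd ltn_eqF // k3 // k2 // /upd ltn_eqF // k1 //.
  by rewrite /upd ltn_eqF.
- rewrite s1n; move: b1 b2 b3; rewrite /upd !eqxx s1n => b1 b2 b3.
  have b4 : tsize (s3 n.+2) <= B (s n).
    by rewrite v3 v2' -{1}(take_size (dec_seq (lst (s n)))); apply: leB.
  have b5 : t3 <= tsize (lst (s n)) * (3 + (tsize (lst (s n)) + B (s n) + tsize (s n) +
     (3 + (tsize (lst (s n)) + B (s n) + tsize (s n))) ^ C + B (s n) + tsize (lst (s n)))) + 1.
    apply: leq_trans b3 _; rewrite leq_add2r leq_mul ?size_dec_seq //.
  by rewrite !leq_add.
Qed.

(** * List operations as folds *)

Lemma tsize_enc_seq (l : seq tree) :
  tsize (enc_seq l) = (\sum_(a <- l) (tsize a).+1).+1.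
Proof. by elim: l => [|a l IH] /=; rewrite ?big_nil // big_cons IH; lia. Qed.

Lemma leq_sum_tsize (F : tree -> nat) (l : seq tree) (S k : nat) :
  tsize (enc_seq l) <= S -> (forall a, tsize a <= S -> F a <= k) ->
  \sum_(a <- l) F a <= size l * k.
Proof.
elim: l => [|a l IH] /= leS leF; first by rewrite big_nil.
by rewrite big_cons mulSn leq_add ?IH ?leF //; lia.
Qed.

Lemma tsize_enc_drop (k : nat) (l : seq tree) : tsize (enc_seq (drop k l)) <= tsize (enc_seq l).
Proof. by rewrite !tsize_enc_seq ltnS -{2}(cat_take_drop k l) big_cat leq_addl. Qed.

Lemma foldl_Cons (l : seq tree) (acc : tree) :
  foldl (fun acc a => Cons a acc) acc l = enc_seq (rev l ++ dec_seq acc).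
Proof.
elim: l acc => [|a l IH] acc /=; first by rewrite dec_seqK.
by rewrite IH /= rev_cons cat_rcons.
Qed.

Lemma tsize_enc_rev (l : seq tree) : tsize (enc_seq (rev l)) = tsize (enc_seq l).
Proof. by rewrite !tsize_enc_seq -!(big_map (fun a => (tsize a).+1) xpredT id) -!sumnE map_rev sumn_rev. Qed.

Lemma tsize_enc_take (k : nat) (l : seq tree) : tsize (enc_seq (take k l)) <= tsize (enc_seq l).
Proof. by rewrite !tsize_enc_seq ltnS -{2}(cat_take_drop k l) big_cat leq_addr. Qed.

Lemma polytime_catrev (f g : tree -> tree) : polytime f -> polytime g ->
  polytime (fun x => enc_seq (rev (dec_seq (f x)) ++ dec_seq (g x))).
Proof.
move=> pf pg; have pid := polytime_id.
have pc : polytime (fun y => Cons (hd y) (hd (tl y))).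
  by apply: polytime_cons; do ?[apply: polytime_hd | apply: polytime_tl].
apply: polytime_ext (polytime_foldl pc pg pf (pboundD (polytime_size pf) (polytime_size pg)) _) => x.
  by rewrite foldl_Cons.
move=> k; rewrite /= foldl_Cons tsize_enc_seq big_cat /= -addSn -tsize_enc_seq tsize_enc_rev.
rewrite leq_add //; first by rewrite -{2}[f x]dec_seqK tsize_enc_take.
by rewrite ltnW // -{2}[g x]dec_seqK tsize_enc_seq.
Qed.

Lemma polytime_rev (f : tree -> tree) :
  polytime f -> polytime (fun x => enc_seq (rev (dec_seq (f x)))).
Proof.
by move=> pf; apply: polytime_ext (polytime_catrev pf polytime_nil) => x; rewrite cats0.
Qed.

Lemma polytime_cat (f g : tree -> tree) : polytime f -> polytime g ->
  polytime (fun x => enc_seq (dec_seq (f x) ++ dec_seq (g x))).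
Proof.
move=> pf pg; apply: polytime_ext (polytime_catrev (polytime_rev pf) pg) => x.
by rewrite enc_seqK revK.
Qed.

Lemma polytime_flatten (f l : tree -> tree) : polytime f -> polytime l ->
  polytime (fun x => enc_seq (flatten [seq dec_seq (f (Cons a x)) | a <- dec_seq (l x)])).
Proof.
move=> pf pl.
have pid := polytime_id.
have pg : polytime (fun y => enc_seq (dec_seq (f (Cons (hd y) (tl (tl y)))) ++ dec_seq (hd (tl y)))).
  apply: polytime_cat; last by apply/polytime_hd/polytime_tl/pid.
  apply: (polytime_comp pf); apply: polytime_cons; first exact: polytime_hd.
  by apply/polytime_tl/polytime_tl.
(* The list is traversed backwards, so that each piece can be put in front of the accumulator. *)
have foldE x s : foldl (fun acc a => enc_seq (dec_seq (f (Cons a x)) ++ dec_seq acc)) Nil (rev s) =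
    enc_seq (flatten [seq dec_seq (f (Cons a x)) | a <- s]).
  by rewrite foldl_rev; elim: s => //= a s ->; rewrite enc_seqK.
have [C leC] := polytime_size pf.
pose B x := tsize (l x) * (3 + tsize (l x) + tsize x) ^ C + 1.
have pB : pbound B.
  have ? := polytime_size pl; have ? := pbound_tsize.
  by do ?[apply: pboundX | apply: pboundD | apply: pboundM | done | exact: pbound_const].
apply: polytime_ext (polytime_foldl pg polytime_nil (polytime_rev pl) pB _) => x.
  by rewrite /= enc_seqK foldE.
move=> k; rewrite /= enc_seqK take_rev foldE; set s := drop _ _.
have le_s : tsize (enc_seq s) <= tsize (l x) by rewrite -[l x]dec_seqK tsize_enc_drop.
rewrite tsize_enc_seq big_flatten /= big_map /B addn1 ltnS.
have le_sz : size s <= tsize (l x) by rewrite (leq_trans _ le_s) // -{1}[s]enc_seqK size_dec_seq.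
apply: leq_trans (leq_mul le_sz (leqnn _)); apply: leq_sum_tsize le_s _ => a le_a.
apply: (@leq_trans (tsize (enc_seq (dec_seq (f (Cons a x)))))).
  by rewrite tsize_enc_seq leqnSn.
rewrite dec_seqK; apply: leq_trans (leC _) _; apply: leq_expl => /=.
by lia.
Qed.

Lemma polytime_map (f l : tree -> tree) : polytime f -> polytime l ->
  polytime (fun x => enc_seq [seq f (Cons a x) | a <- dec_seq (l x)]).
Proof.
move=> pf pl; apply: polytime_ext (polytime_flatten (polytime_cons pf polytime_nil) pl) => x.
by rewrite /= flatten_map1.
Qed.

Lemma polytime_allpairs (f g : tree -> tree) : polytime f -> polytime g ->
  polytime (fun x => enc_seq [seq Cons a b | a <- dec_seq (f x), b <- dec_seq (g x)]).
Proof.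
move=> pf pg; have pid := polytime_id.
have pc : polytime (fun z => Cons (hd (tl z)) (hd z)).
  by apply: polytime_cons; do ?[apply: polytime_hd | apply: polytime_tl].
apply: polytime_ext (polytime_flatten (polytime_map pc (polytime_comp pg (polytime_tl pid))) pf) => x /=.
by congr (enc_seq (flatten _)); apply: eq_map => a; rewrite enc_seqK.
Qed.

(** The fold applies [tl] once for each element of the unary number. *)
Lemma polytime_drop (f g : tree -> tree) : polytime f -> polytime g ->
  polytime (fun x => enc_seq (drop (dec_unary (g x)) (dec_seq (f x)))).
Proof.
move=> pf pg; have pid := polytime_id.
have foldE (l : seq tree) acc : foldl (fun acc _ => tl acc) acc l = enc_seq (drop (size l) (dec_seq acc)).
  elim: l acc => [|a l IH] acc /=; rewrite ?drop0 ?dec_seqK ?IH //.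
  by case: acc => //= _ acc; rewrite ?drop_oversize.
apply: polytime_ext (polytime_foldl (polytime_tl (polytime_hd (polytime_tl pid))) pf pg (polytime_size pf) _) => x.
  by rewrite foldE.
by move=> k /=; rewrite foldE -{2}[f x]dec_seqK tsize_enc_drop.
Qed.

Lemma hdE (t : tree) : hd t = head Nil (dec_seq t).
Proof. by case: t. Qed.

Lemma polytime_entry (f g : tree -> tree) : polytime f -> polytime g ->
  polytime (fun x => entry (f x) (dec_unary (g x))).
Proof.
move=> pf pg; apply: polytime_ext (polytime_hd (polytime_drop pf pg)) => x.
by rewrite hdE enc_seqK -nth0 nth_drop addn0.
Qed.

(** * Boolean tests and unary numbers *)

Definition polybool (b : tree -> bool) : Prop := polytime (fun x => enc_bit (b x)).

Lemma is_cons_bit (b : bool) : is_cons (enc_bit b) = b.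
Proof. by case: b. Qed.

Lemma polytime_ifb (b : tree -> bool) (f g : tree -> tree) :
  polybool b -> polytime f -> polytime g -> polytime (fun x => if b x then f x else g x).
Proof.
by move=> pb pf pg; apply: polytime_ext (polytime_if pb pf pg) => x; rewrite is_cons_bit.
Qed.

Lemma polytime_one : polytime (fun=> Cons Nil Nil).
Proof. exact: polytime_cons polytime_nil polytime_nil. Qed.

Lemma polybool_is_cons (f : tree -> tree) : polytime f -> polybool (fun x => is_cons (f x)).
Proof.
by move=> pf; apply: polytime_ext (polytime_if pf polytime_one polytime_nil) => x; case: is_cons.
Qed.

Lemma polybool_and (b c : tree -> bool) :
  polybool b -> polybool c -> polybool (fun x => b x && c x).
Proof.
by move=> pb pc; apply: polytime_ext (polytime_ifb pb pc polytime_nil) => x; case: (b x).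
Qed.

Lemma polybool_or (b c : tree -> bool) :
  polybool b -> polybool c -> polybool (fun x => b x || c x).
Proof.
by move=> pb pc; apply: polytime_ext (polytime_ifb pb polytime_one pc) => x; case: (b x).
Qed.

Lemma polybool_not (b : tree -> bool) : polybool b -> polybool (fun x => ~~ b x).
Proof.
by move=> pb; apply: polytime_ext (polytime_ifb pb polytime_nil polytime_one) => x; case: (b x).
Qed.

Lemma polybool_if (a b c : tree -> bool) :
  polybool a -> polybool b -> polybool c -> polybool (fun x => if a x then b x else c x).
Proof.
by move=> pa pb pc; apply: polytime_ext (polytime_ifb pa pb pc) => x; case: (a x).
Qed.

Lemma polybool_ltn (f g : tree -> tree) : polytime f -> polytime g ->
  polybool (fun x => dec_unary (f x) < dec_unary (g x)).
Proof.
move=> pf pg; apply: polytime_ext (polybool_is_cons (polytime_drop pg pf)) => x.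
congr enc_bit; rewrite -subn_gt0 -size_drop /dec_unary.
by case: (drop _ _).
Qed.

Lemma polybool_eqn (f g : tree -> tree) : polytime f -> polytime g ->
  polybool (fun x => dec_unary (f x) == dec_unary (g x)).
Proof.
move=> pf pg.
apply: polytime_ext (polybool_and (polybool_not (polybool_ltn pf pg))
                                  (polybool_not (polybool_ltn pg pf))) => x.
by congr enc_bit; rewrite -!leqNgt andbC -eqn_leq.
Qed.

Lemma rev_unaries (n : nat) :
  rev (map enc_unary (iota 0 n.+1)) = enc_unary n :: rev (map enc_unary (iota 0 n)).
Proof. by rewrite -addn1 iotaD map_cat rev_cat. Qed.

Lemma tsize_enc_unary (n : nat) : tsize (enc_unary n) = (n * 2).+1.
Proof. by elim: n => //= n; rewrite -/(enc_unary n) => ->. Qed.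

Lemma polytime_iota (f : tree -> tree) : polytime f ->
  polytime (fun x => enc_seq (map enc_unary (iota 0 (dec_unary (f x))))).
Proof.
move=> pf; have pid := polytime_id.
(* The step pushes the successor of the number on top. Starting from the list of 0 alone, this
   yields the numbers up to n in decreasing order, hence the [tl] and the reversal below. *)
have pg : polytime (fun y => Cons (Cons Nil (hd (hd (tl y)))) (hd (tl y))).
  by do ?[apply: polytime_cons | apply: polytime_hd | apply: polytime_tl | exact: polytime_nil | done].
have foldE (l : seq tree) : foldl (fun acc _ => Cons (Cons Nil (hd acc)) acc) (Cons Nil Nil) l =
    enc_seq (rev (map enc_unary (iota 0 (size l).+1))).
  elim/last_ind: l => [|l a IH] //.
  by rewrite foldl_rcons IH size_rcons !rev_unaries.
have pB : pbound (fun x => (tsize (f x) + 1) * (2 * tsize (f x) + 2) + 1).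
  have ? := polytime_size pf.
  by do ?[apply: pboundD | apply: pboundM | done | exact: pbound_const].
apply: polytime_ext (polytime_rev (polytime_tl (polytime_foldl pg polytime_one pf pB _))) => x /=.
  by rewrite foldE rev_unaries /= enc_seqK revK.
move=> k; rewrite foldE tsize_enc_rev tsize_enc_seq addn1 ltnS big_map.
rewrite -{1}[(size _).+1]subn0 -/(index_iota 0 _) big_mkord.
have le_n : size (take k (dec_seq (f x))) <= tsize (f x).
  by rewrite (leq_trans _ (size_dec_seq _)) // size_take_min geq_minr.
apply: (@leq_trans (\sum_(i < (size (take k (dec_seq (f x)))).+1) (2 * tsize (f x) + 2))).
  by apply: leq_sum => i _; rewrite tsize_enc_unary; have := ltn_ord i; lia.
by rewrite sum_nat_const card_ord leq_mul // addn1 ltnS.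
Qed.

(** * Writing down the instance *)

Lemma polytime_const (y : tree) : polytime (fun=> y).
Proof. by elim: y => [|l IHl r IHr]; [exact: polytime_nil|exact: polytime_cons]. Qed.

(* In the environment of [cell], the instance is [Cons y L], and on top of it are
   the row (i, j), the column (((a, b), w), s), and the state transition (u, v). *)
Definition cell (z : tree) : tree :=
  let v := hd z in let u := hd (tl z) in
  let c := hd (tl (tl z)) in let q := hd (tl (tl (tl z))) in
  let x := tl (tl (tl (tl z))) in
  let s := tl c in let w := tl (hd c) in let a := hd (hd (hd c)) in let b := tl (hd (hd c)) in
  let i := hd q in let j := tl q in
  if ((dec_unary (Cons Nil j) == dec_unary (tl x)) || (dec_unary u == dec_unary v)) &&
     (if dec_unary i < dec_unary j then
        (dec_unary a == dec_unary i) && ((dec_unary b == dec_unary j) &&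
        ((~~ (dec_unary u == dec_unary w) &&
          (is_cons (entry (entry (hd x) (dec_unary u)) (dec_unary w)) &&
           is_cons (entry (entry (hd x) (dec_unary w)) (dec_unary u)))) &&
         (dec_unary u < dec_unary w)))
      else
        (dec_unary a == dec_unary j) && ((dec_unary b == dec_unary i) &&
        ((dec_unary s == dec_unary Nil) && ((dec_unary u == dec_unary w) &&
         (dec_unary u < dec_unary (hd x))))))
  then if is_cons s then enc_rat (-1)%R else enc_rat 1%R else Nil.

Ltac polytime_tac := repeat lazymatch goal with
  | |- polytime (fun z => z) => exact: polytime_id
  | |- polytime (fun z => Cons (@?f z) (@?g z)) => apply: (@polytime_cons f g)
  | |- polytime (fun z => hd (@?f z)) => apply: (@polytime_hd f)
  | |- polytime (fun z => tl (@?f z)) => apply: (@polytime_tl f)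
  | |- polytime (fun z => entry (@?f z) (dec_unary (@?g z))) => apply: (@polytime_entry f g)
  | |- polytime (fun z => if _ then _ else _) => apply: polytime_ifb
  | |- polytime (fun z => ?y) => exact: (polytime_const y)
  | |- polybool (fun z => @?b z && @?c z) => apply: (@polybool_and b c)
  | |- polybool (fun z => @?b z || @?c z) => apply: (@polybool_or b c)
  | |- polybool (fun z => ~~ @?b z) => apply: (@polybool_not b)
  | |- polybool (fun z => is_cons (@?f z)) => apply: (@polybool_is_cons f)
  | |- polybool (fun z => dec_unary (@?f z) < dec_unary (@?g z)) => apply: (@polybool_ltn f g)
  | |- polybool (fun z => dec_unary (@?f z) == dec_unary (@?g z)) => apply: (@polybool_eqn f g)
  | |- polybool (fun z => if _ then _ else _) => apply: polybool_if
  end.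

Lemma polytime_cell : polytime cell.
Proof. by cbv beta zeta delta [cell]; polytime_tac. Qed.

(** The added [Nil] accounts for the phantom vertex. *)
Definition states (x : tree) : tree :=
  enc_seq (map enc_unary (iota 0 (dec_unary (Cons Nil (hd x))))).

Definition pairs (x : tree) : tree :=
  let r := enc_seq (map enc_unary (iota 0 (dec_unary (tl x)))) in
  enc_seq [seq Cons i j | i <- dec_seq r, j <- dec_seq r].

Definition bits : tree := enc_seq [:: Nil; Cons Nil Nil].

(** The lexicographic order makes the components at position x the digits of x that occur in
    [weight]. *)
Definition columns (x : tree) : tree :=
  enc_seq [seq Cons h s | h <- dec_seq (enc_seq [seq Cons q w | q <- dec_seq (pairs x),
    w <- dec_seq (states x)]), s <- dec_seq bits].

Definition cell_mx (z : tree) : tree :=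
  enc_seq [seq enc_seq [seq cell (Cons v (Cons u z)) | v <- dec_seq (states (tl (tl z)))]
    | u <- dec_seq (states (tl (tl z)))].

(** The leading [Nil] decodes to the zero matrix in column 0. *)
Definition gate_row (z : tree) : tree :=
  Cons Nil (enc_seq [seq cell_mx (Cons c z) | c <- dec_seq (columns (tl z))]).

Definition jump_mx (x : tree) : tree :=
  enc_seq [seq enc_seq [seq enc_rat 1%R | _ <- dec_seq (states x)] | _ <- dec_seq (states x)].

Definition gates_tree (x : tree) : tree :=
  Cons (Cons (jump_mx x) Nil) (enc_seq [seq gate_row (Cons q x) | q <- dec_seq (pairs x)]).

(* Only the length matters; it is the number n of columns, padded to a power so
   large that n^[eps] exceeds the dimension that the matrices need. *)
Fixpoint column_list (r : nat) (x : tree) : tree :=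
  if r is r'.+1 then
    enc_seq [seq Cons a b | a <- dec_seq (enc_seq [seq Cons a b | a <- dec_seq (Cons Nil (pairs x)),
       b <- dec_seq (enc_seq [seq Cons a b | a <- dec_seq (states x), b <- dec_seq bits])]),
       b <- dec_seq (column_list r' x)]
  else Cons Nil Nil.

(** In order: n as the length of a list, the first dimension to try (N + 1), the matrix, and the
    number l * l + 1 of rows as the length of a list. *)
Definition prepare (r : nat) (x : tree) : tree :=
  Cons (column_list r x) (Cons (Cons Nil (hd x)) (Cons (gates_tree x) (Cons Nil (pairs x)))).

Lemma polytime_states (f : tree -> tree) : polytime f -> polytime (fun x => states (f x)).
Proof.
by move=> pf; apply/polytime_iota/polytime_cons; [apply: polytime_nil|apply: polytime_hd].
Qed.

Lemma polytime_pairs : polytime pairs.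
Proof.
have pi := polytime_iota (polytime_tl polytime_id).
exact: (polytime_allpairs pi pi).
Qed.

Lemma polytime_columns (f : tree -> tree) : polytime f -> polytime (fun x => columns (f x)).
Proof.
have pc : polytime columns; last by move=> pf; apply: polytime_comp.
apply: polytime_allpairs (polytime_const bits).
exact: polytime_allpairs polytime_pairs (polytime_states polytime_id).
Qed.

Lemma polytime_gates_tree : polytime gates_tree.
Proof.
have pid := polytime_id; have ps := polytime_states.
have pm : polytime cell_mx.
  apply: (@polytime_map (fun z => enc_seq [seq cell (Cons v z) | v <- dec_seq (states (tl (tl (tl z))))])
    (fun z => states (tl (tl z)))); last by apply/ps/polytime_tl/polytime_tl.
  by apply: (polytime_map polytime_cell); apply/ps/polytime_tl/polytime_tl/polytime_tl.
have pr : polytime gate_row.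
  by apply: (polytime_cons polytime_nil); apply: (polytime_map pm); apply/polytime_columns/polytime_tl.
apply: polytime_cons; last exact: polytime_map pr polytime_pairs.
apply: polytime_cons polytime_nil.
have psi := ps _ pid.
apply: (@polytime_map (fun z => enc_seq [seq enc_rat 1%R | _ <- dec_seq (states (tl z))]) states _ psi).
exact: (@polytime_map (fun=> enc_rat 1%R) _ (polytime_const _) (ps _ (polytime_tl pid))).
Qed.

Lemma polytime_prepare (r : nat) : polytime (prepare r).
Proof.
have pid := polytime_id; have psi := polytime_states pid.
apply: polytime_cons; last first.
  apply: (polytime_cons (polytime_cons polytime_nil (polytime_hd pid))).
  exact: (polytime_cons polytime_gates_tree (polytime_cons polytime_nil polytime_pairs)).
elim: r => [|r IHr]; first exact: polytime_const.
apply: polytime_allpairs IHr; apply: polytime_allpairs.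
  exact: polytime_cons polytime_nil polytime_pairs.
exact: polytime_allpairs psi (polytime_const bits).
Qed.

(** * Decoding the instance *)

Lemma nth_allpairs (S T U : Type) (f : S -> T -> U) (s : seq S) (t : seq T) (x0 : S) (y0 : T) (z0 : U) (k : nat) :
  k < size s * size t ->
  nth z0 [seq f x y | x <- s, y <- t] k = f (nth x0 s (k %/ size t)) (nth y0 t (k %% size t)).
Proof.
elim: s k => [|x s IH] k //=; rewrite mulSn => lt_k.
have t_gt0 : 0 < size t by case: (size t) lt_k => //; rewrite muln0.
rewrite nth_cat size_map; case: ltnP => [lt_kt|le_tk].
  by rewrite (nth_map y0) // divn_small // modn_small.
rewrite IH; last by rewrite -(ltn_add2l (size t)) subnKC.
rewrite -{3 4}(subnKC le_tk) divnDl // divnn t_gt0 modnDl add1n /=.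
by [].
Qed.

Lemma size_states (y L : tree) : size (dec_seq (states (Cons y L))) = (dec_unary y).+1.
Proof. by rewrite enc_seqK size_map size_iota. Qed.

Lemma nth_states (y L : tree) (u : nat) : u < (dec_unary y).+1 ->
  nth Nil (dec_seq (states (Cons y L))) u = enc_unary u.
Proof. by move=> lt_u; rewrite enc_seqK (nth_map 0) ?size_iota // nth_iota. Qed.

Lemma size_pairs (y L : tree) :
  size (dec_seq (pairs (Cons y L))) = dec_unary L * dec_unary L.
Proof. by rewrite enc_seqK size_allpairs !enc_seqK size_map size_iota. Qed.

Lemma nth_pairs (y L : tree) (p : nat) (l := dec_unary L) : p < l * l ->
  nth Nil (dec_seq (pairs (Cons y L))) p = Cons (enc_unary (p %/ l)) (enc_unary (p %% l)).
Proof.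
move=> lt_p; have l_gt0 : 0 < l by case: l lt_p => //; rewrite muln0.
rewrite enc_seqK (nth_allpairs _ Nil Nil) !enc_seqK !size_map !size_iota //=.
rewrite !(nth_map 0) ?size_iota ?ltn_mod ?ltn_divLR //.
by rewrite !nth_iota ?ltn_mod ?ltn_divLR.
Qed.

Lemma dec_columns (x : tree) : dec_seq (columns x) =
  [seq Cons h s | h <- [seq Cons q w | q <- dec_seq (pairs x), w <- dec_seq (states x)],
                  s <- [:: Nil; Cons Nil Nil]].
Proof.
by rewrite /columns enc_seqK (enc_seqK (allpairs _ _ _)) /bits (enc_seqK [:: _; _]).
Qed.

Lemma size_columns (y L : tree) :
  size (dec_seq (columns (Cons y L))) = dec_unary L * dec_unary L * (dec_unary y).+1 * 2.
Proof. by rewrite dec_columns !size_allpairs size_pairs size_states. Qed.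

Lemma nth_columns (y L : tree) (x : nat) (l := dec_unary L) (m := (dec_unary y).+1) :
  x < l * l * m * 2 ->
  nth Nil (dec_seq (columns (Cons y L))) x =
  Cons (Cons (Cons (enc_unary (x %/ 2 %/ m %/ l)) (enc_unary (x %/ 2 %/ m %% l)))
    (enc_unary (x %/ 2 %% m))) (enc_unary (x %% 2)).
Proof.
move=> lt_x; rewrite dec_columns (nth_allpairs _ Nil Nil); last first.
  by rewrite size_allpairs size_pairs size_states.
have lt_x2 : x %/ 2 < l * l * m by rewrite ltn_divLR.
rewrite [size [:: _; _]]/= (nth_allpairs _ Nil Nil) ?size_pairs ?size_states //.
rewrite nth_pairs ?ltn_divLR // nth_states ?ltn_mod //.
by congr Cons; have := ltn_pmod x (isT : 0 < 2); case: (x %% 2) => [|[]].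
Qed.
Arguments states : simpl never.
Arguments pairs : simpl never.
Arguments columns : simpl never.
Arguments cell : simpl never.

Lemma dec_rat_nil : dec_rat Nil = 0%R.
Proof. by rewrite /dec_rat /= /dec_nat /= mul0r mulr0. Qed.

Lemma entry_nil (i : nat) : entry Nil i = Nil.
Proof. by rewrite /entry nth_nil. Qed.

Lemma dec_mx_nil (d : nat) : dec_mx d Nil = 0%R.
Proof. by apply/matrixP => u v; rewrite !mxE !entry_nil dec_rat_nil. Qed.

Lemma cellE (y L : tree) (i j a b w s u v : nat) : s < 2 ->
  dec_rat (cell (Cons (enc_unary v) (Cons (enc_unary u)
    (Cons (Cons (Cons (Cons (enc_unary a) (enc_unary b)) (enc_unary w)) (enc_unary s))
      (Cons (Cons (enc_unary i) (enc_unary j)) (Cons y L)))))) =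
  (((j.+1 == dec_unary L) || (u == v))%:R *
    ((-1) ^+ s * (live (up_edge y) (dec_unary y) i j a b w s u)%:R))%R.
Proof.
move=> lt_s; rewrite /cell /=.
have -> : dec_unary (Cons Nil (enc_unary j)) = j.+1.
  by rewrite -[in RHS](enc_unaryK j).
rewrite !enc_unaryK -[dec_unary Nil]/0.
set t1 := (_ || _).
have -> : live (up_edge y) (dec_unary y) i j a b w s u =
  (if i < j then (a == i) && ((b == j) && (((u != w) &&
          (is_cons (entry (entry y u) w) && is_cons (entry (entry y w) u))) && (u < w)))
   else (a == j) && ((b == i) && ((s == 0) && ((u == w) && (u < dec_unary y))))) by [].
set t2 := (if i < j then _ else _).
case: t1; case: t2; rewrite ?mulr0 ?mul0r ?dec_rat_nil //= mulr1 mul1r.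
by case: s lt_s => [|[]] //= _; rewrite enc_ratK ?expr0 ?expr1.
Qed.

Lemma entry_map (f : tree -> tree) (l : tree) (i : nat) :
  entry (enc_seq [seq f a | a <- dec_seq l]) i =
  if i < dec_unary l then f (entry l i) else Nil.
Proof.
rewrite /entry enc_seqK; case: ltnP => [lt_i|le_i]; first by rewrite (nth_map Nil).
by rewrite nth_default // size_map.
Qed.

(** Whatever the tree omits decodes to 0, so the main point is that [gates] vanishes on padding
    columns ([weight_out]) and padding states ([weight_ge]). *)
Lemma gates_treeE (y L : tree) (d n : nat) (N := dec_unary y) (l := dec_unary L) :
  (\matrix_(p < (l * l).+1, c < n)
    dec_mx d (entry (entry (gates_tree (Cons y L)) p) c))%R =
  gates rat (up_edge y) N N.+1 l d n.
Proof.
have unE x : dec_unary x = size (dec_seq x) by [].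
apply/matrixP => p c; rewrite !mxE.
case Ep : (p : nat) => [|q].
  rewrite [entry (gates_tree _) 0]/=; case: eqP => [->|/eqP neq_c]; last first.
    by case: (c : nat) neq_c => // c' _; rewrite /entry /= nth_nil dec_mx_nil.
  rewrite [entry (Cons _ _) _]/=; apply/matrixP => u v; rewrite !mxE.
  rewrite (@entry_map (fun=> _)) unE size_states.
  case: ltnP => lt_u; last by rewrite entry_nil dec_rat_nil.
  rewrite (@entry_map (fun=> _)) unE size_states.
  by case: ltnP => lt_v; rewrite ?dec_rat_nil ?enc_ratK.
have lt_p := ltn_ord p; rewrite Ep in lt_p.
have [l_gt0 lt_i lt_j] := row_div (erefl q.+1) lt_p.
rewrite -[entry (gates_tree _) _]/(entry (enc_seq _) q).
rewrite (@entry_map (fun q => gate_row (Cons q _))) unE size_pairs ifT //.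
rewrite /entry -/(entry _ c) nth_pairs //.
case Ec : (c : nat) => [|x].
  rewrite [entry _ _]/= dec_mx_nil; apply/matrixP => u v.
  by rewrite !mxE mulr0.
rewrite -[entry (gate_row _) _]/(entry (enc_seq _) x).
rewrite (@entry_map (fun c => cell_mx (Cons c _))) unE -[tl _]/(Cons y L) size_columns.
case: ltnP => lt_x; last first.
  rewrite dec_mx_nil; apply/matrixP => u v.
  by rewrite !mxE weight_out ?mulr0 // mulnA.
rewrite {1}/entry nth_columns //.
apply/matrixP => u v; rewrite !mxE.
rewrite (@entry_map (fun u => enc_seq [seq cell (Cons v (Cons u _)) | v <- _])) unE -[tl _]/(Cons y L) size_states.
case: ltnP => lt_u; last first.
  rewrite entry_nil dec_rat_nil weight_ge ?mulr0 ?(ltnW lt_u) //; exact: up_edge_lt.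
rewrite (@entry_map (fun v => cell (Cons v _))) unE size_states.
(* A target state past N is excluded by v < m in the last gate of a group and by u = v in the other
   gates. *)
case: ltnP => lt_v; last first.
  rewrite dec_rat_nil; case: (_ == l); first by rewrite mul0r.
  by case: eqP => [E|_]; [move: lt_u; rewrite E ltnNge lt_v|rewrite mul0r].
rewrite /entry !nth_states // cellE ?ltn_mod //.
Qed.

(** * The size of the oracle's answers *)

Definition int_bounded (B : nat) (q : rat) : Prop :=
  exists z : int, q = z%:~R%R /\ `|z| <= B.

(** Answers count towards the running time, so the entries of [rdet] need short encodings;
    integrality keeps the denominators at 1. *)
Definition mx_bounded (d B : nat) (M : 'M[rat]_d) : Prop :=
  forall u v, int_bounded B (M u v).

Lemma int_boundedM (B B' : nat) (q q' : rat) :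
  int_bounded B q -> int_bounded B' q' -> int_bounded (B * B') (q * q')%R.
Proof.
move=> [z [-> le_z]] [z' [-> le_z']]; exists (z * z')%R; rewrite rmorphM.
by rewrite abszM leq_mul.
Qed.

Lemma int_bounded_sum (I : finType) (B : nat) (F : I -> rat) :
  (forall i, int_bounded B (F i)) -> int_bounded (#|I| * B) (\sum_i F i)%R.
Proof.
move=> leF; rewrite cardE -[X in int_bounded _ X]big_enum /=.
elim: (enum I) => [|i s [z [Ez le_z]]]; first by rewrite big_nil; exists 0%R.
rewrite big_cons Ez; have [z' [-> le_z']] := leF i.
exists (z' + z)%R; rewrite rmorphD; split=> //=.
rewrite mulSn; move: le_z le_z'; lia.
Qed.

Lemma mx_bounded_prod (d k B : nat) (F : 'I_k -> 'M[rat]_d) :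
  (forall i, mx_bounded 1 (F i)) -> mx_bounded (d ^ k) (\prod_(i < k) F i)%R.
Proof.
elim: k F => [|k IH] F leF u v.
  by rewrite big_ord0 mxE; exists (u == v)%:R%R; rewrite rmorph_nat; case: (u == v).
rewrite big_ord_recr /= mxE expnS -{1}(card_ord d); apply: int_bounded_sum => i.
rewrite -[d ^ k]muln1; apply: int_boundedM; last exact: leF.
by apply: IH => j; apply: leF.
Qed.

Lemma absz_inv_sign (k n : nat) (f : 'I_k -> 'I_n) : `|inv_sign f| <= 1.
Proof.
do 2!(apply: (big_ind (fun z : int => `|z| <= 1)) => //;
  [by move=> x y le_x le_y; rewrite abszM (leq_mul le_x le_y)|move=> ? _]).
by rewrite absz_sg; case: (_ == _).
Qed.

(** By [rdetE] there are n ^ k terms, each a signed product of k matrices with entries at most d ^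
    k. *)
Lemma mx_bounded_rdet (k n d : nat) (A : 'M['M[rat]_d]_(k, n)) :
  (forall p c, mx_bounded 1 (A p c)) -> mx_bounded (n ^ k * d ^ k) (rdet A).
Proof.
move=> leA u v; rewrite rdetE summxE.
have -> : n ^ k = #|{ffun 'I_k -> 'I_n}| by rewrite card_ffun !card_ord.
apply: int_bounded_sum => f; rewrite -scaler_int mxE -[_ ^ k]mul1n.
apply: int_boundedM; last exact: mx_bounded_prod.
by exists (inv_sign f); rewrite absz_inv_sign.
Qed.

Lemma mx_bounded_gates (e : rel nat) (N m l d n : nat) p c :
  mx_bounded 1 (gates rat e N m l d n p c).
Proof.
move=> u v; rewrite mxE; case: (p : nat) => [|q].
  case: eqP => _; rewrite mxE; last by exists 0%R.
  by exists (((u < m) && (v < m))%N%:R)%R; rewrite rmorph_nat; case: (_ && _).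
rewrite mxE -(muln1 1); apply: int_boundedM.
  set b := (if _ then _ else _); exists b%:R%R; rewrite rmorph_nat.
  by case: (b).
case: (c : nat) => [|x]; first by exists 0%R.
rewrite /weight -(muln1 1); apply: int_boundedM.
  by exists ((-1) ^+ (x %% 2))%R; rewrite rmorphXn rmorphN1 abszX exp1n.
set b := live _ _ _ _ _ _ _ _ _; exists b%:R%R; rewrite rmorph_nat.
by case: (b).
Qed.

Lemma tsize_enc_nat (k e : nat) : k < 2 ^ e -> tsize (enc_nat k) <= (e * 4).+1.
Proof.
move=> lt_k; rewrite tsize_enc_seq big_map ltnS.
(* A bit has size at most 3, and its list cell adds 1. *)
apply: (@leq_trans (\sum_(i <- iota 0 (up_log 2 k.+1)) 4)).
  by apply: leq_sum => i _; case: (odd _).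
rewrite big_const_seq count_predT size_iota iter_addn_0 mulnC leq_mul2r.
exact: up_log_min.
Qed.

Lemma tsize_enc_rat (B e : nat) (q : rat) : int_bounded B q -> B < 2 ^ e ->
  tsize (enc_rat q) <= e * 4 + 11.
Proof.
move=> [z [-> le_z]] lt_B; rewrite /= numq_int denq_int.
(* The constant 11 is 1 from the numerator, 5 for the denominator 1, 3 for the sign bit and 2 for
   the inner nodes. *)
have := tsize_enc_nat (leq_ltn_trans le_z lt_B).
have := @tsize_enc_nat `|1%R : int| 1 isT.
have : tsize (enc_bit (z%:~R < 0 :> rat)%R) <= 3 by case: (_ < _)%R.
by lia.
Qed.

Lemma tsize_enc_mx (B e d : nat) (M : 'M[rat]_d) : mx_bounded B M -> B < 2 ^ e ->
  tsize (enc_mx M) <= d * (d * (e * 4 + 12) + 2) + 1.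
Proof.
move=> leM lt_B.
have le_sum (F : 'I_d -> nat) c : (forall i, F i <= c) -> \sum_(i <- enum 'I_d) F i <= d * c.
  move=> leF; rewrite big_enum /= -[X in _ <= X * _]card_ord -sum_nat_const.
  by apply: leq_sum => i _.
rewrite tsize_enc_seq big_map addn1 ltnS; apply: (le_sum _ _) => i.
rewrite tsize_enc_seq big_map addn2 !ltnS; apply: le_sum => j.
by have := tsize_enc_rat (leM i j) lt_B; lia.
Qed.

(** * Running the reduction *)

Fixpoint expr_vars (e : expr) : nat :=
  match e with
  | EVar v => v.+1
  | ENil => 0
  | ECons e1 e2 => maxn (expr_vars e1) (expr_vars e2)
  | EHd e => expr_vars e
  | ETl e => expr_vars e
  end.

Fixpoint cmd_vars (c : cmd) : nat :=
  match c with
  | Assign v e => maxn v.+1 (expr_vars e)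
  | Query v e => maxn v.+1 (expr_vars e)
  | Seq c1 c2 => maxn (cmd_vars c1) (cmd_vars c2)
  | If e c1 c2 => maxn (expr_vars e) (maxn (cmd_vars c1) (cmd_vars c2))
  | While e c => maxn (expr_vars e) (cmd_vars c)
  end.

Lemma eval_frame (B : nat) (s s2 : store) (e : expr) :
  (forall v, v < B -> s2 v = s v) -> expr_vars e <= B -> eval s2 e = eval s e.
Proof.
move=> eq_s; elim: e => [v||e1 IH1 e2 IH2|e IH|e IH] /=; rewrite ?geq_max.
- exact: eq_s.
- by [].
- by case/andP=> /IH1 -> /IH2 ->.
- by move/IH ->.
- by move/IH ->.
Qed.

(** A run reads and writes only variables that its program mentions; so values can be parked at B
    and above while an unknown program runs. *)
Lemma exec_frame (O : tree -> tree) (c : cmd) (s s' : store) (t : nat) (qs : seq tree) :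
  exec O c s s' t qs -> forall (B : nat) (s2 : store),
  cmd_vars c <= B -> (forall v, v < B -> s2 v = s v) ->
  exists s2', [/\ exec O c s2 s2' t qs, forall v, v < B -> s2' v = s' v &
    forall v, B <= v -> s2' v = s2 v].
Proof.
elim=> {c s s' t qs} /=.
- move=> v e s B s2; rewrite geq_max => /andP[lt_v le_e] eq_s.
  exists (upd s2 v (eval s2 e)); rewrite -(eval_frame eq_s le_e); split=> [|w lt_w|w le_w].
  + exact: XAssign.
  + by rewrite /upd eq_s.
  + by rewrite /upd gtn_eqF // (leq_trans lt_v).
- move=> v e s B s2; rewrite geq_max => /andP[lt_v le_e] eq_s.
  exists (upd s2 v (O (eval s2 e))); rewrite -(eval_frame eq_s le_e); split=> [|w lt_w|w le_w].
  + exact: XQuery.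
  + by rewrite /upd eq_s.
  + by rewrite /upd gtn_eqF // (leq_trans lt_v).
- move=> c1 c2 s s1 s2 t1 t2 qs1 qs2 _ IH1 _ IH2 B r; rewrite geq_max => /andP[le1 le2] eq_r.
  have [r1 [e1 v1 k1]] := IH1 B r le1 eq_r; have [r2 [e2 v2 k2]] := IH2 B r1 le2 v1.
  by exists r2; split=> // [|v le_v]; [exact: XSeq e1 e2|rewrite k2 // k1].
- move=> e c1 c2 s s' t qs bE _ IH B r; rewrite !geq_max => /and3P[le_e le1 le2] eq_r.
  have [r1 [e1 v1 k1]] := IH B r le1 eq_r; exists r1; split=> //.
  by apply: XIfTrue => //; rewrite (eval_frame eq_r).
- move=> e c1 c2 s s' t qs bE _ IH B r; rewrite !geq_max => /and3P[le_e le1 le2] eq_r.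
  have [r1 [e1 v1 k1]] := IH B r le2 eq_r; exists r1; split=> //.
  by apply: XIfFalse => //; rewrite (eval_frame eq_r).
- move=> e c s s1 s2 t1 t2 qs1 qs2 bE _ IH1 _ IH2 B r le_B eq_r.
  have := le_B; rewrite !geq_max => /andP[le_e le1].
  have [r1 [e1 v1 k1]] := IH1 B r le1 eq_r; have [r2 [e2 v2 k2]] := IH2 B r1 le_B v1.
  exists r2; split=> // [|v le_v]; last by rewrite k2 // k1.
  by apply: XWhileTrue e1 e2; rewrite (eval_frame eq_r).
- move=> e c s bE B r; rewrite geq_max => /andP[le_e _] eq_r.
  by exists r; split=> //; apply: XWhileFalse; rewrite (eval_frame eq_r).
Qed.

(** A program certifying membership in #W[1] runs with an oracle that always answers [Nil].
    Assigning [Nil] directly gives the same run under any oracle, without queries that would have to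
    respect the parameter bound. *)
Fixpoint oracle_free (c : cmd) : cmd :=
  match c with
  | Assign v e => Assign v e
  | Query v _ => Assign v ENil
  | Seq c1 c2 => Seq (oracle_free c1) (oracle_free c2)
  | If e c1 c2 => If e (oracle_free c1) (oracle_free c2)
  | While e c => While e (oracle_free c)
  end.

Lemma exec_oracle_free (O : tree -> tree) (c : cmd) (s s' : store) (t : nat) (qs : seq tree) :
  exec (fun=> Nil) c s s' t qs ->
  exists2 t', exec O (oracle_free c) s s' t' [::] & t' <= t.
Proof.
elim=> {c s s' t qs} /=.
- by move=> v e s; exists (tsize (eval s e)) => //; apply: XAssign.
- by move=> v e s; exists 1; [exact: (XAssign O v ENil s)|rewrite addn1].
- move=> c1 c2 s s1 s2 t1 t2 qs1 qs2 _ [t1' e1 le1] _ [t2' e2 le2].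
  by exists (t1' + t2'); [exact: XSeq e1 e2|rewrite leq_add].
- by move=> e c1 c2 s s' t qs bE _ [t' e1 le1]; exists t'.+1 => //; apply: XIfTrue.
- by move=> e c1 c2 s s' t qs bE _ [t' e1 le1]; exists t'.+1 => //; apply: XIfFalse.
- move=> e c s s1 s2 t1 t2 qs1 qs2 bE _ [t1' e1 le1] _ [t2' e2 le2].
  by exists (t1' + t2').+1; [exact: XWhileTrue bE e1 e2|rewrite ltnS leq_add].
- by move=> e c s bE; exists 1 => //; apply: XWhileFalse.
Qed.

Lemma computable_comp (f : nat -> nat) (f' : nat -> nat) (h : tree -> tree) :
  computable f -> polytime h ->
  (forall k, h (Cons (enc_unary k) (enc_unary (f k))) = enc_unary (f' k)) -> computable f'.
Proof.
move=> [c cP] [T [ch [_ hP]]] hE.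
(* Variable B keeps a copy of the input k while [c] computes f k; it must differ from the input
   variable 0. *)
pose B := maxn 1 (cmd_vars c).
exists (Seq (Assign B (EVar 0)) (Seq c (Seq (Assign 0 (ECons (EVar B) (EVar 0))) (ch 0)))) => k.
have [t [qs [s e sE]]] := cP k.
have B_gt0 : 0 < B by rewrite leq_max.
have [|v lt_v|s2 [e2 v2 k2]] := exec_frame e (B := B) (s2 := upd (init (enc_unary k)) B (enc_unary k)).
- by rewrite leq_max leqnn orbT.
- by rewrite /upd ltn_eqF.
have s2B : s2 B = enc_unary k by rewrite k2 // /upd eqxx.
have s20 : s2 0 = enc_unary (f k) by rewrite v2.
have [s3 [t3 [e3 v3 _ _]]] := hP (fun=> Nil) 0 (upd s2 0 (Cons (s2 B) (s2 0))).
eexists; eexists; exists s3; last by rewrite v3 /upd eqxx s2B s20 hE.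
apply: XSeq; first exact: XAssign.
apply: XSeq; first exact: e2.
by apply: XSeq; [exact: XAssign|exact: e3].
Qed.

(** * Unary arithmetic and the dimension n^eps *)

Definition polyunary (u : tree -> nat) : Prop := polytime (fun x => enc_unary (u x)).

Lemma enc_unary_map (y : tree) : enc_seq [seq Nil | _ <- dec_seq y] = enc_unary (dec_unary y).
Proof. by rewrite /enc_unary /dec_unary; elim: (dec_seq y) => //= _ s ->. Qed.

Lemma polyunary_dec (f : tree -> tree) : polytime f -> polyunary (fun x => dec_unary (f x)).
Proof.
move=> pf; apply: polytime_ext (polytime_map polytime_nil pf) => x.
exact: enc_unary_map.
Qed.

Lemma polyunaryD (u w : tree -> nat) : polyunary u -> polyunary w -> polyunary (fun x => u x + w x).
Proof.
move=> pu pw; apply: polytime_ext (polyunary_dec (polytime_cat pu pw)) => x.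
by rewrite /dec_unary !enc_seqK size_cat !size_nseq.
Qed.

Lemma polyunaryM (u w : tree -> nat) : polyunary u -> polyunary w -> polyunary (fun x => u x * w x).
Proof.
move=> pu pw; apply: polytime_ext (polyunary_dec (polytime_allpairs pu pw)) => x.
by rewrite /dec_unary !enc_seqK size_allpairs !size_nseq.
Qed.

Lemma polyunaryX (u : tree -> nat) (e : nat) : polyunary u -> polyunary (fun x => u x ^ e).
Proof.
move=> pu; elim: e => [|e IHe]; first exact: polytime_const.
by apply: polytime_ext (polyunaryM pu IHe) => x; rewrite expnS.
Qed.
(** An r of at least 1/eps gives (b^r)^eps >= b, and an E of at least eps keeps the dimension
    polynomial in the number b^r of columns. *)
Lemma floor_powR (R : realType) (eps : R) : (0 < eps)%R ->
  exists r E, 0 < r /\ forall b, 0 < b -> exists D,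
    [/\ b <= D, D <= (b ^ r) ^ E, (D%:R <= (b ^ r)%:R `^ eps)%R &
        ((b ^ r)%:R `^ eps < D.+1%:R)%R].
Proof.
move=> eps_gt0.
pose r := Num.bound eps^-1%R; exists r, (Num.bound eps).
have r_eps : (1 <= r%:R * eps)%R.
  rewrite -ler_pdivrMr // div1r ltW //; apply: archi_boundP.
  by rewrite invr_ge0 ltW.
split=> [|b b_gt0]; first by case: r r_eps => //; rewrite mul0r ler10.
have b_ge1 : (1 <= b%:R :> R)%R by rewrite ler1n.
have n_ge1 : (1 <= (b ^ r)%:R :> R)%R by rewrite ler1n expn_gt0 b_gt0.
set x := ((b ^ r)%:R `^ eps)%R; have x_ge0 : (0 <= x)%R by apply: powR_ge0.
have /andP[le_D lt_D] := truncn_itv x_ge0.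
exists (Num.truncn x); split=> //.
- rewrite truncn_ge_nat // /x natrX -powR_mulrn ?ler0n // -powRrM.
  by rewrite -{1}[b%:R%R]powRr1 ?ler0n // ler_powR.
- rewrite -(ler_nat R) natrX (le_trans le_D) // /x -powR_mulrn ?ler0n //.
  by rewrite ler_powR // ltW // archi_boundP // ltW.
Qed.

(* Variable 2 holds the dimension, which grows as long as the answer is [Nil]. *)
Definition query_loop : cmd :=
  While (EVar 5)
    (Seq (Query 6 (ECons (ECons (EVar 1) (ECons (EVar 2) (EVar 3))) (EVar 4)))
         (If (EVar 6) (Assign 5 ENil) (Assign 2 (ECons ENil (EVar 2))))).

Definition query_tree (n d M K : tree) : tree := Cons (Cons n (Cons d M)) K.

(** The induction is on the number i of dimensions still to be rejected. Each rejection enlarges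
    variable 2 by 2, and S reserves room for all of them. *)
Lemma exec_query_loop (O : tree -> tree) (n M K ans : tree) (D : nat) :
  is_cons ans ->
  (forall d, dec_unary d < D -> O (query_tree n d M K) = Nil) ->
  (forall d, dec_unary d = D -> O (query_tree n d M K) = ans) ->
  forall i s (S : nat), [/\ s 1 = n, s 3 = M, s 4 = K & is_cons (s 5)] ->
  dec_unary (s 2) + i = D -> tsize n + (tsize (s 2) + i * 2) + tsize M + tsize K <= S ->
  exists s' t qs, [/\ exec O query_loop s s' t qs, s' 6 = ans,
    t <= i.+1 * (S * 2 + tsize ans + 10) + 1 &
    all (fun q => dec_unary (tl q) == dec_unary K) qs].
Proof.
move=> ans_cons wrong right; elim=> [|i IH] s S [s1 s3 s4 s5] Ed le_S.
  have OE : O (query_tree (s 1) (s 2) (s 3) (s 4)) = ans.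
    by rewrite s1 s3 s4; apply: right; rewrite -Ed addn0.
  set q := query_tree (s 1) (s 2) (s 3) (s 4) in OE.
  exists (upd (upd s 6 ans) 5 Nil), (((tsize q + tsize ans) + 2) + 1).+1, ([:: q] ++ [::]).
  split; last by rewrite /= s4 eqxx.
  - apply: (@XWhileTrue _ _ _ _ _ _ _ _ [:: q] [::]) => //.
      apply: (@XSeq _ _ _ _ _ _ _ _ [:: q] [::]).
        have := XQuery O 6 (ECons (ECons (EVar 1) (ECons (EVar 2) (EVar 3))) (EVar 4)) s.
        by rewrite -[eval s _]/q OE; apply.
      by apply: XIfTrue; [rewrite /= /upd eqxx|exact: (XAssign O 5 ENil)].
    exact: XWhileFalse.
  - by [].
  - by rewrite /q /= s1 s3 s4; lia.
have OE : O (query_tree (s 1) (s 2) (s 3) (s 4)) = Nil.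
  by rewrite s1 s3 s4; apply: wrong; lia.
set q := query_tree (s 1) (s 2) (s 3) (s 4) in OE.
pose r := upd (upd s 6 Nil) 2 (Cons Nil (s 2)).
have [|||s' [t' [qs' [e' v' b' a']]]] := IH r S.
- by [].
- by rewrite -Ed /r /upd /= /dec_unary /= addnS.
- by rewrite /r /upd /=; move: le_S; rewrite /=; lia.
exists s', (((tsize q + 1) + (tsize (Cons Nil (s 2))).+1) + t').+1, ([:: q] ++ qs').
split=> //; last by rewrite /= s4 eqxx.
  apply: (@XWhileTrue _ _ _ _ _ _ _ _ [:: q] _ _ _ e') => //.
  apply: (@XSeq _ _ _ _ _ _ _ _ [:: q] [::]).
    have := XQuery O 6 (ECons (ECons (EVar 1) (ECons (EVar 2) (EVar 3))) (EVar 4)) s.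
    by rewrite -[eval s _]/q OE; apply.
  by apply: XIfFalse; [by []|exact: (XAssign O 2 (ECons ENil (EVar 2)) (upd s 6 Nil))].
rewrite mulSn /q /= s1 s3 s4; move: b' le_S; set X := _ * _; set Y := i.+1 * _.
by lia.
Qed.

(** * The complete program *)

Lemma head_enc_mx (d : nat) (M : 'M[rat]_d) (u : 'I_d) : u = 0 :> nat ->
  hd (hd (enc_mx M)) = enc_rat (M u u).
Proof.
case: d => [|d] in M u *; first by case: u.
move=> u0; have -> : u = ord0 by apply: ord_inj.
by rewrite /enc_mx enum_ordSl.
Qed.

(** [enc_rat] stores the sign apart from the absolute value of the numerator, so reading only the
    latter discards the sign left open by [rdet_gates]. *)
Lemma absz_num_rdet_gates (y : tree) (l d n : nat) (N := dec_unary y) :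
  N < d -> l * l * (N.+1 * 2) < n ->
  hd (tl (hd (hd (enc_mx (rdet (gates rat (up_edge y) N N.+1 l d n)))))) =
  enc_nat (sharp_clique y l).
Proof.
move=> lt_Nd lt_n; have d_gt0 := leq_ltn_trans (leq0n N) lt_Nd.
rewrite (@head_enc_mx _ _ (Ordinal d_gt0)) //=.
have [b ->] := @rdet_gates rat _ _ _ _ _ (Ordinal d_gt0) (@up_edge_lt y) lt_Nd erefl lt_n.
rewrite -sharp_cliqueE; congr enc_nat.
have -> : ((-1) ^+ b * (sharp_clique y l)%:R = (((-1) ^+ b * (sharp_clique y l)%:Z)%R : int)%:~R :> rat)%R.
  by rewrite rmorphM rmorph_sign.
by rewrite numq_int abszM absz_sign mul1n.
Qed.

Lemma size_column_list (r : nat) (y L : tree) (l := dec_unary L) :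
  dec_unary (column_list r (Cons y L)) = ((l * l).+1 * ((dec_unary y).+1 * 2)) ^ r.
Proof.
elim: r => [|r IHr]; first by [].
rewrite expnS -IHr /dec_unary.
rewrite enc_seqK size_allpairs; congr (_ * _).
rewrite enc_seqK size_allpairs -[size (dec_seq (Cons _ _))]/(size (dec_seq (pairs (Cons y L)))).+1 size_pairs.
congr (_ * _).
by rewrite enc_seqK size_allpairs size_states.
Qed.

Lemma rdet_problemE (R : realType) (eps : R) (n d M K : tree) :
  oracle (rdet_problem eps) (query_tree n d M K) =
  (if [&& dec_unary K <= dec_unary n,
     ((dec_unary d)%:R <= (dec_unary n)%:R `^ eps)%R &
     ((dec_unary n)%:R `^ eps < (dec_unary d).+1%:R)%R] then
   enc_mx (rdet (\matrix_(i < dec_unary K, j < dec_unary n)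
     dec_mx (dec_unary d) (entry (entry M i) j))%R) else Nil).
Proof. by []. Qed.

Lemma exec_assign (O : tree -> tree) (v : nat) (e : expr) (s : store) (t : tree) :
  eval s e = t -> exec O (Assign v e) s (upd s v t) (tsize t) [::].
Proof. by move=> <-; apply: XAssign. Qed.

Lemma clique_query (R : realType) (eps : R) : (0 < eps)%R ->
  exists c T, pbound T /\ forall s y L, s 0 = Cons y L -> let l := dec_unary L in
  exists s' t qs, [/\ exec (oracle (rdet_problem eps)) c s s' t qs,
    s' 0 = enc_nat (sharp_clique y l), t <= T (Cons y L) &
    all (fun q => dec_unary (tl q) == (l * l).+1) qs].
Proof.
move=> /floor_powR[r [E [r_gt0 floorP]]].
have pp := polytime_prepare r; have szp := polytime_size pp.
have [Tp [cp [pTp cpP]]] := pp.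
exists (Seq (cp 0) (Seq (Assign 1 (EHd (EVar 0))) (Seq (Assign 2 (EHd (ETl (EVar 0))))
  (Seq (Assign 3 (EHd (ETl (ETl (EVar 0))))) (Seq (Assign 4 (ETl (ETl (ETl (EVar 0)))))
  (Seq (Assign 5 (ECons ENil ENil)) (Seq query_loop
    (Assign 0 (EHd (ETl (EHd (EHd (EVar 6))))))))))))).
(* Z stands for the size of the prepared instance and bounds the numbers of rows and columns; Z ^ E
   bounds the dimension. [Ab] bounds the answer, [W] the time after the preparation. *)
pose Ab Z := Z ^ E * (Z ^ E * ((Z * Z ^ E * Z + 1) * 4 + 12) + 2) + 1.
pose W Z := 4 * Z + 3 + ((Z ^ E + 1) * ((Z + 2 * Z ^ E) * 2 + Ab Z + 10) + 1 + Ab Z).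
have pW (Z : tree -> nat) : pbound Z -> pbound (fun x => W (Z x)).
  move=> pZ; rewrite /W /Ab.
  by do ?[done | apply: pboundX | apply: pboundD | apply: pboundM | exact: pbound_const].
exists (fun x => Tp x + W (tsize (prepare r x))); split; first exact: pboundD (pW _ szp).
move=> s y L s0 l; have [s1 [t1 [e1 v1 _ b1]]] := cpP (oracle (rdet_problem eps)) 0 s.
rewrite s0 in v1 b1; set x := Cons y L in v1 b1 *.
set n := column_list r x; set M := gates_tree x; set K := Cons Nil (pairs x).
set d0 := Cons Nil (hd x).
set Z := tsize (prepare r x); have Z_eq : Z = (tsize n + (tsize d0 + (tsize M + tsize K).+1).+1).+1 by [].
(* b is the base of the padding, n = b ^ r. It exceeds both N and the number of block columns and is
   at least the number of rows, so any dimension D >= b suffices. *)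
pose N := dec_unary y; pose b := (l * l).+1 * (N.+1 * 2).
have b_gt0 : 0 < b by [].
have [D [le_bD le_DE le_D lt_D]] := floorP b b_gt0.
have nE : dec_unary n = b ^ r by apply: size_column_list.
have KE : dec_unary K = (l * l).+1 by rewrite /K /dec_unary /= size_pairs.
have le_bn : b <= b ^ r by rewrite -{1}(expn1 b) leq_pexp2l.
have lt_nb : l * l * (N.+1 * 2) < b by rewrite /b ltn_pmul2r.
have le_KD : (l * l).+1 <= b by rewrite leq_pmulr.
have lt_ND : N < D by apply: leq_trans le_bD; rewrite /b; nia.
pose ans := enc_mx (rdet (gates rat (up_edge y) N N.+1 l D (b ^ r))).
have ans_right d : dec_unary d = D -> oracle (rdet_problem eps) (query_tree n d M K) = ans.
  move=> dE; rewrite rdet_problemE dE nE KE (leq_trans le_KD le_bn) le_D lt_D /=.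
  by congr (enc_mx (rdet _)); apply: (gates_treeE y L).
(* Below D the condition n^eps < d + 1 fails. *)
have ans_wrong d : dec_unary d < D -> oracle (rdet_problem eps) (query_tree n d M K) = Nil.
  move=> lt_dD; rewrite rdet_problemE nE [X in [&& _, _ & X]]ltNge.
  have -> : ((dec_unary d).+1%:R <= (b ^ r)%:R `^ eps)%R by rewrite (le_trans _ le_D) // ler_nat.
  by rewrite !andbF.
have ans_cons : is_cons ans.
  by rewrite /ans; case: (D) lt_ND => // D' _; rewrite /enc_mx enum_ordSl.
pose s2 := upd (upd (upd (upd (upd s1 1 n) 2 d0) 3 M) 4 K) 5 (Cons Nil Nil).
have d0E : dec_unary d0 = N.+1 by [].
have le_ans : tsize ans <= Ab Z.
  have le_nZ : b ^ r <= Z by rewrite -nE (leq_trans (size_dec_seq _)) // Z_eq; lia.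
  have le_DZ : D <= Z ^ E by rewrite (leq_trans le_DE) // leq_expl.
  have le_KZ : (l * l).+1 <= Z by rewrite -KE (leq_trans (size_dec_seq _)) // Z_eq; lia.
  have bnd : mx_bounded ((b ^ r) ^ (l * l).+1 * D ^ (l * l).+1)
      (rdet (gates rat (up_edge y) N N.+1 l D (b ^ r))).
    by apply: mx_bounded_rdet => p c; apply: mx_bounded_gates.
  (* Bit lengths need a power of two; x < 2 ^ x provides one whose exponent is polynomial in Z. *)
  have lt_exp : (b ^ r) ^ (l * l).+1 * D ^ (l * l).+1 < 2 ^ (b ^ r * D * (l * l).+1 + 1).
    rewrite -expnMn addn1 (leq_ltn_trans (n := 2 ^ (b ^ r * D * (l * l).+1))) //; last first.
      by rewrite ltn_exp2l.
    by rewrite expnM leq_expl // ltnW // ltn_expl.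
  apply: leq_trans (tsize_enc_mx bnd lt_exp) _.
  by rewrite /Ab leq_add2r; do ![apply: leq_mul => // | rewrite leq_add2r].
(* The search starts at N.+1, so D - N.+1 queries are rejected before the accepted one. *)
have [||s3 [t3 [qs [e3 v3 b3 a3]]]] := @exec_query_loop _ n M K ans D ans_cons ans_wrong ans_right
  (D - N.+1) s2 (Z + 2 * D) (And4 erefl erefl erefl isT) _ _.
- by rewrite -[s2 2]/d0 d0E subnKC.
- by rewrite -[s2 2]/d0 Z_eq; lia.
exists (upd s3 0 (enc_nat (sharp_clique y l))).
exists (t1 + (tsize n + (tsize d0 + (tsize M + (tsize K + (3 + (t3 + tsize (enc_nat (sharp_clique y l))))))))), (qs ++ [::]).
have out : hd (tl (hd (hd ans))) = enc_nat (sharp_clique y l).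
  by apply: absz_num_rdet_gates => //; apply: leq_trans lt_nb le_bn.
split; last by rewrite cats0 -KE.
- apply: (@XSeq _ _ _ _ _ _ _ _ [::] _ e1).
  do 4![apply: (@XSeq _ _ _ _ _ _ _ _ [::]); first by apply: exec_assign; rewrite /= /upd /= ?v1].
  apply: (@XSeq _ _ _ _ _ _ _ _ [::]).
    exact: (@exec_assign _ 5 (ECons ENil ENil) _ (Cons Nil Nil) erefl).
  apply: (@XSeq _ _ _ _ _ _ _ _ qs [::]); first exact: e3.
  by apply: exec_assign; rewrite /= v3.
- by [].
- have le_out : tsize (enc_nat (sharp_clique y l)) <= Ab Z.
    rewrite -out (leq_trans (tsize_hd _)) // (leq_trans (tsize_tl _)) //.
    by rewrite (leq_trans (tsize_hd _)) // (leq_trans (tsize_hd _)).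
  have le_t3 : t3 <= (Z ^ E + 1) * ((Z + 2 * Z ^ E) * 2 + Ab Z + 10) + 1.
    apply: leq_trans b3 _; rewrite leq_add2r.
    have le_DZ : D <= Z ^ E.
      rewrite (leq_trans le_DE) // leq_expl // -nE (leq_trans (size_dec_seq _)) // Z_eq; lia.
    by apply: leq_mul; lia.
  by rewrite leq_add // /W; move: le_out le_t3; rewrite Z_eq; lia.
Qed.

(** The parsimonious reduction of F to counting cliques, made oracle-free, is followed by the
    program of [clique_query]. *)
Lemma sharpW1_hard_rdet (R : realType) (eps : R) : (0 < eps)%R ->
  sharpW1_hard (rdet_problem eps).
Proof.
move=> /clique_query[c [T [[C leC] cP]]] F [c0 [f [g [e [cf cg redP]]]]].
have pid := polytime_id.
have ph := polyunary_dec (polytime_hd pid); have pt := polyunary_dec (polytime_tl pid).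
(* With X the product of f k + 2k + 4 and the (e + 1)-st power of the input size, the two phases
   take time at most X and X ^ C, and X + X ^ C <= X ^ (C + 2) as X > 1. The second function counts
   the rows for cliques of size at most g k. *)
exists (Seq (oracle_free c0) c), (fun k => (f k + (k * 2 + 4)) ^ (C + 2)),
  (fun k => (g k * g k + 1)), ((e + 1) * (C + 2)); split.
- have p : polyunary (fun x => (dec_unary (tl x) + (dec_unary (hd x) * 2 + 4)) ^ (C + 2)).
    apply/polyunaryX/(polyunaryD pt)/polyunaryD; last exact: (polytime_const (enc_unary 4)).
    exact: (polyunaryM ph (polytime_const (enc_unary 2))).
  by apply: (computable_comp cf p) => k; rewrite /= !enc_unaryK.
- have p : polyunary (fun x => dec_unary (tl x) * dec_unary (tl x) + 1).
    exact: (polyunaryD (polyunaryM pt pt) (polytime_const (enc_unary 1))).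
  by apply: (computable_comp cg p) => k; rewrite /= !enc_unaryK.
move=> x k; have [y [l [t [[qs [s e0 s0]] le_t le_l ->]]]] := redP x k.
have [t1 e1 le_t1] := exec_oracle_free (oracle (rdet_problem eps)) e0.
have [s' [t' [qs' [e' v' b' a']]]] := cP s _ _ s0.
rewrite enc_unaryK in v' a'.
exists (t1 + t'), ([::] ++ qs'); split; last 1 first.
- apply: sub_all a' => q /eqP->; rewrite addn1 ltnS leq_mul //.
- by exists s'; [exact: XSeq e1 e'|].
have sz : tsize (enc_inst y l) <= tsize (enc_inst x k) + t.
  by rewrite -s0; exact: exec_tsize e0 0.
have x_gt0 := tsize_gt0 x.
have szx : tsize (enc_inst x k) = tsize x + k * 2 + 2.
  by rewrite /= tsize_enc_unary; lia.
pose X := (f k + (k * 2 + 4)) * tsize x ^ (e + 1).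
have X_gt1 : 1 < X by rewrite /X (leq_trans (n := 4 * 1)) // leq_mul ?expn_gt0 ?x_gt0 //; lia.
have le_X : tsize x + k * 2 + 3 + f k * tsize x ^ e <= X.
  have le1 : tsize x ^ e <= tsize x ^ (e + 1) by apply: leq_expD.
  have le2 : tsize x <= tsize x ^ (e + 1) by rewrite -{1}(expn1 (tsize x)) addnC leq_expD.
  rewrite /X mulnDl addnC leq_add // ?leq_mul //.
  by rewrite mulnDl; nia.
have le_tX : t1 <= X.
  by apply: leq_trans le_X; apply: leq_trans le_t1 (leq_trans le_t (leq_addl _ _)).
have le_t'X : t' <= X ^ C.
  apply: leq_trans b' _; apply: leq_trans (leC _) _; apply: leq_expl; apply: leq_trans le_X.
  by rewrite -/(enc_inst y l); move: sz le_t; rewrite szx; set A := f k * _; lia.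
rewrite expnM -expnMn -/X addn2 !expnS.
have X_ge1 : 0 < X ^ C by rewrite expn_gt0 (ltnW X_gt1).
apply: leq_trans (leq_mul X_gt1 (leqnn _)); rewrite mul2n -addnn leq_add //.
  by apply: leq_trans le_tX _; rewrite leq_pmulr.
by apply: leq_trans le_t'X _; rewrite leq_pmull // ltnW.
Qed.

Unset Implicit Arguments.
Local Open Scope ring_scope.

Theorem theorem3 (R : realType) (eps : R) (heps : 0 < eps) :
  sharpW1_hard (rdet_problem eps).
Proof. exact: sharpW1_hard_rdet. Qed.
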